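(* Let $p\geq 1$ and let $\Gamma$ and $\Lambda$ be finitely generated groups. Assume that we are in one of the following situations: \begin{itemize} \item[(i)] $\Gamma$ is an $\mathrm L^p$ measure quotient of $\Lambda$; \item[(ii)] $\Gamma$ is an at most $m$-to-one $\mathrm L^p$ measure sub-quotient of $\Lambda$, for some $m\in\mathbb N$. \end{itemize} Then $j_{p,\Gamma}\succcurlyeq j_{p,\Lambda}$.
   Context: Isoperimetric profile. For a finitely generated group $G$ with finite symmetric generating set $S_G$, $p\ge 1$ and $f\colon G\to\mathbb R$ finitely supported, put $\|\nabla^l_{S_G} f\|_p^p=\sum_{g\in G,\,s\in S_G}|f(sg)-f(g)|^p$, and $j_{p,G}(n)=\sup\left\{\|f\|_p/\|\nabla^l_{S_G} f\|_p\colon f\neq 0,\ |\operatorname{supp} f|\le n\right\}$ (the ratio is $+\infty$ if the gradient vanishes, which can only happen if $G$ is finite). For monotone functions, $g\succcurlyeq f$ means that there is a constant $C>0$ with $f(n)=O(g(Cn))$ as $n\to\infty$. Measure couplings. Let $S_\Lambda$ be a finite symmetric generating set of $\Lambda$. A measure sub-quotient coupling from $\Gamma$ to $\Lambda$ is a triple $(\Omega,X_\Lambda,\mu)$ where $(\Omega,\mu)$ is a standard Borel space with a nonzero $\sigma$-finite measure, equipped with commuting measure-preserving actions of $\Gamma$ and $\Lambda$ (denoted $*$), each admitting a fundamental domain (a Borel set meeting almost every orbit in exactly one point), such that the $\Gamma$-action is free (up to null sets) and $X_\Lambda$ is a fundamental domain of finite measure for the $\Lambda$-action (the $\Lambda$-action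 is not assumed to be free). It is a measure quotient coupling if moreover the $\Gamma$-action has a fundamental domain of finite measure. The group $\Gamma$ acts on $X_\Lambda$ by $\{\gamma\cdot x\}=(\Lambda*\gamma*x)\cap X_\Lambda$. For $y\in\Lambda*x$ put $d_{S_\Lambda}(x,y)=\min\{n\colon \exists s_1,\dots,s_n\in S_\Lambda,\ y=s_1\cdots s_n*x\}$. The coupling is $\mathrm L^p$ if $\int_{X_\Lambda}d_{S_\Lambda}(\gamma\cdot x,\gamma*x)^p\,d\mu(x)<\infty$ for every $\gamma\in\Gamma$. It is at most $m$-to-one if for every $x\in X_\Lambda$ the map $\Gamma\to\Lambda*x$, $\gamma\mapsto\gamma^{-1}*(\gamma\cdot x)$, has preimages of points of size at most $m$. The group $\Gamma$ is an $\mathrm L^p$ measure quotient (resp. at most $m$-to-one $\mathrm L^p$ measure sub-quotient) of $\Lambda$ if there is such a quotient (resp. sub-quotient) coupling from $\Gamma$ to $\Lambda$. *)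

(* Defs.v *)
From HB Require Import structures.
From mathcomp Require Import all_boot all_order all_algebra.
From mathcomp Require Import all_classical all_reals all_analysis.

Set Implicit Arguments.
Unset Strict Implicit.
Unset Printing Implicit Defensive.
Import Order.TTheory GRing.Theory Num.Theory.

Local Open Scope classical_set_scope.
Local Open Scope card_scope.
Local Open Scope ring_scope.

Definition symmetric_generating_set (G : groupType) (S : set G) : Prop :=
  [/\ finite_set S,
      forall s, S s -> S (s^-1)%g &
      forall g, exists2 w : seq G, [set` w] `<=` S & g = (\prod_(s <- w) s)%g].

Section IsoperimetricProfile.
Variables (R : realType) (p : R) (G : groupType) (S : set G).

(* The sums \sum_(_ \in _) below range over the (finite) support of the
   summand; they are only used for finitely supported f and finite S. *)
Definition pnorm (f : G -> R) : R :=
  (\sum_(g \in [set: G]) `|f g| `^ p) `^ p^-1.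

Definition grad_pnorm (f : G -> R) : R :=
  (\sum_(g \in [set: G]) \sum_(s \in S) `|f (s * g)%g - f g| `^ p) `^ p^-1.

Definition sobolev_ratio (f : G -> R) : \bar R :=
  if grad_pnorm f == 0 then +oo%E else (pnorm f / grad_pnorm f)%:E.

Definition isoperimetric_profile (n : nat) : \bar R :=
  ereal_sup [set sobolev_ratio f | f in
    [set f : G -> R | f <> cst 0 /\ [set g | f g != 0] #<= `I_n]].

End IsoperimetricProfile.

(* g(Cn) for a real C > 0 is read as g(floor(Cn)).  For the profile this loses
   nothing: #|supp f| <= Cn iff #|supp f| <= floor(Cn). *)
Definition dominates (R : realType) (g f : nat -> \bar R) : Prop :=
  exists2 C : R, 0 < C &
  exists2 K : R, 0 < K &
    \forall n \near \oo, (f n <= K%:E * g (Num.truncn (C * n%:R)))%E.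

(* The sigma-algebra of T is the Borel sigma-algebra of a Polish topology,
   carried by a type P in bijection with T. *)
Definition standard_borel (R : realType) (d : measure_display)
    (T : measurableType d) : Prop :=
  exists (P : completePseudoMetricType R) (h : T -> P),
    [/\ hausdorff_space P,
        exists2 Q : set P, countable Q & dense Q,
        bijective h &
        forall A : set T, measurable A <-> <<s @open P >> (h @` A)].

Section Actions.
Variables (R : realType) (d : measure_display) (T : measurableType d).
Variable mu : {measure set T -> \bar R}.

Definition is_action (G : groupType) (a : G -> T -> T) : Prop :=
  (forall x, a 1%g x = x) /\ (forall g h x, a (g * h)%g x = a g (a h x)).

Definition measure_preserving (G : groupType) (a : G -> T -> T) : Prop :=
  forall g, measurable_fun [set: T] (a g) /\
    forall A, measurable A -> mu (a g @^-1` A) = mu A.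

Definition action_orbit (G : groupType) (a : G -> T -> T) (x : T) : set T :=
  [set a g x | g in [set: G]].

Definition ess_free (G : groupType) (a : G -> T -> T) : Prop :=
  {ae mu, forall x, forall g, a g x = x -> g = 1%g}.

Definition fundamental_domain (G : groupType) (a : G -> T -> T) (D : set T) :
    Prop :=
  measurable D /\
  {ae mu, forall x, exists y, action_orbit a x `&` D = [set y]}.

(* Word distance in an orbit; it is +oo when y is not in the orbit of x. *)
Definition orbit_dist (G : groupType) (S : set G) (a : G -> T -> T) (x y : T) :
    \bar R :=
  ereal_inf [set ((size w)%:R)%:E | w in
    [set w : seq G | [set` w] `<=` S /\ y = a (\prod_(s <- w) s)%g x]].

End Actions.

Section Couplings.
Variables (R : realType) (Gam Lam : groupType).
Variables (d : measure_display) (T : measurableType d).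
Variable mu : {measure set T -> \bar R}.
Variables (aG : Gam -> T -> T) (aL : Lam -> T -> T) (X : set T).

Record subquotient_coupling : Prop := SubquotientCoupling {
  sqc_standard_borel : standard_borel R T;
  sqc_sigma_finite : sigma_finite [set: T] mu;
  sqc_nonzero : mu [set: T] <> 0%E;
  sqc_actionG : is_action aG;
  sqc_actionL : is_action aL;
  sqc_commute : forall g l x, aG g (aL l x) = aL l (aG g x);
  sqc_preservingG : measure_preserving mu aG;
  sqc_preservingL : measure_preserving mu aL;
  sqc_freeG : ess_free mu aG;
  sqc_domainG : exists D, fundamental_domain mu aG D;
  sqc_domainL : fundamental_domain mu aL X;
  sqc_finiteL : (mu X < +oo)%E }.

Record quotient_coupling : Prop := QuotientCoupling {
  qc_subquotient : subquotient_coupling;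
  qc_finiteG : exists2 D, fundamental_domain mu aG D & (mu D < +oo)%E }.

(* The induced action of Gam on X.  Its value is meaningful when
   induced_defined holds, which is the case for almost every x; elsewhere it is
   a junk value. *)
Definition induced_defined (g : Gam) (x : T) : Prop :=
  exists y, action_orbit aL (aG g x) `&` X = [set y].

Definition induced (g : Gam) (x : T) : T :=
  xget x (action_orbit aL (aG g x) `&` X).

Definition Lp_coupling (p : R) (S : set Lam) : Prop :=
  forall g,
    (\int[mu]_(x in X) (orbit_dist R S aL (induced g x) (aG g x)) `^ p < +oo)%E.

Definition at_most_to_one (m : nat) : Prop :=
  forall x, X x -> (forall g, induced_defined g x) ->
  forall z, [set g : Gam | aG (g^-1)%g (induced g x) = z] #<= `I_m.

End Couplings.

Definition Lp_measure_quotient (R : realType) (p : R) (Gam Lam : groupType)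
    (S : set Lam) : Prop :=
  exists (d : measure_display) (T : measurableType d)
    (mu : {measure set T -> \bar R})
    (aG : Gam -> T -> T) (aL : Lam -> T -> T) (X : set T),
    quotient_coupling mu aG aL X /\ Lp_coupling mu aG aL X p S.

Definition Lp_measure_subquotient_to_one (R : realType) (p : R) (m : nat)
    (Gam Lam : groupType) (S : set Lam) : Prop :=
  exists (d : measure_display) (T : measurableType d)
    (mu : {measure set T -> \bar R})
    (aG : Gam -> T -> T) (aL : Lam -> T -> T) (X : set T),
    [/\ subquotient_coupling mu aG aL X, Lp_coupling mu aG aL X p S
      & at_most_to_one aG aL X m].

(* Main.v *)
(* Given f on Lam, set F(y)^p = sum of |f l|^p over the l with l*y in X, and pull
   F back to Gam along the orbit map of a point z of a fundamental
   domain D of Gam: phi_z(g) = F(g*z).  Integrating over D and unfolding turns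
   sums over Gam into integrals over the whole space, so on average over D:
   - the p-th power of the norm of phi_z has mass |f|^p mu(X);
   - that of its gradient has mass at most K |grad f|^p, because s*x differs from
     s.x by a word of length d(s.x, s*x), whose p-th power is integrable (reverse
     Minkowski inequality);
   - its support has mass at most |supp f| mu(X).
   Finding one z that is good for all three needs uniform integrability: the
   number of points of X in a Gam-orbit is finite almost everywhere, so X has a
   subset of at least half its measure on which it is at most some M.  Only this
   part of X is counted in the norm; the mass lost where |supp phi_z| > 4M|supp f|
   is then at most a quarter of the total. *)
Require Import Defs.
From mathcomp Require Import all_boot all_order all_algebra finmap.
From mathcomp Require Import all_classical all_reals all_analysis.
From mathcomp Require Import measurable_realfun ring lra.
Set Implicit Arguments.
Unset Strict Implicit.
Unset Printing Implicit Defensive.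
Import Order.TTheory GRing.Theory Num.Theory.
Local Open Scope classical_set_scope.
Local Open Scope card_scope.
Local Open Scope ring_scope.

(** * Minkowski's inequality for finite sums *)

Section Minkowski.
Variables (R : realType) (p : R).
Hypothesis hp : 1 <= p.

Let p_gt0 : 0 < p. Proof. exact: lt_le_trans hp. Qed.
Let p_ge0 : 0 <= p. Proof. exact: ltW. Qed.
Let p_neq0 : p != 0. Proof. exact: lt0r_neq0. Qed.

Lemma powR_invK (x : R) : 0 <= x -> (x `^ p^-1) `^ p = x.
Proof. by move=> x0; rewrite -powRrM mulVf// powRr1. Qed.

Lemma powRK_inv (x : R) : 0 <= x -> (x `^ p) `^ p^-1 = x.
Proof. by move=> x0; rewrite -powRrM mulfV// powRr1. Qed.

Lemma powR_quotient (x y : R) : 0 <= x -> 0 <= y -> (x / y) `^ p = x `^ p / y `^ p.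
Proof.
by move=> x0 y0; rewrite powRM ?invr_ge0// -[in LHS]powR_inv1// -powRrM mulN1r powRN.
Qed.

Lemma powR_convex2 (x y a b : R) : 0 <= x -> 0 <= y -> 0 <= a -> 0 <= b ->
  a + b = 1 -> (a * x + b * y) `^ p <= a * x `^ p + b * y `^ p.
Proof.
move=> x0 y0 a0 b0 ab1.
have a1 : a <= 1 by lra.
have := @convex_powR R p hp (Itv01 a0 a1) x y.
rewrite !inE/= !in_itv/= !andbT => /(_ x0 y0).
have bE : b = 1 - a by lra.
rewrite !convRE /= bE. done.
Qed.

(** Covers the degenerate case of Minkowski's inequality, where normalising by the norm of [a] would
    divide by zero: a vanishing sum of p-th powers forces every [a i] to vanish. *)
Lemma sum_powR_absorb (I : Type) (r : seq I) (a b : I -> R) :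
  \sum_(i <- r) `|a i| `^ p = 0 ->
  \sum_(i <- r) `|a i + b i| `^ p = \sum_(i <- r) `|b i| `^ p.
Proof.
elim: r => [|i r IH]; first by rewrite !big_nil.
have ge0 : 0 <= \sum_(j <- r) `|a j| `^ p by apply: sumr_ge0 => *; exact: powR_ge0.
rewrite !big_cons => /eqP; rewrite paddr_eq0 ?powR_ge0//.
by move=> /andP[/eqP/powR_eq0_eq0/normr0_eq0 -> /eqP/IH ->]; rewrite add0r.
Qed.

Lemma minkowski_powR (I : Type) (r : seq I) (a b : I -> R) (al be : R) :
  0 <= al -> 0 <= be ->
  \sum_(i <- r) `|a i| `^ p = al `^ p -> \sum_(i <- r) `|b i| `^ p = be `^ p ->
  \sum_(i <- r) `|a i + b i| `^ p <= (al + be) `^ p.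
Proof.
move=> al0 be0 AE BE.
have [al_eq0|alN0] := eqVneq al 0.
  by rewrite al_eq0 add0r -BE sum_powR_absorb// AE al_eq0 powR0.
have [be_eq0|beN0] := eqVneq be 0.
  rewrite be_eq0 addr0 -AE; under eq_bigr do rewrite addrC.
  by rewrite sum_powR_absorb// BE be_eq0 powR0.
have alp : 0 < al by rewrite lt0r alN0 al0.
have bep : 0 < be by rewrite lt0r beN0 be0.
have abp : 0 < al + be by exact: addr_gt0.
(* convexity of x^p at |a|/al and |b|/be with weights al/(al+be), be/(al+be) *)
apply: (@le_trans _ _ (\sum_(i <- r) (al + be) `^ p *
   (al / (al + be) * ((`|a i| `^ p) / al `^ p) + be / (al + be) * ((`|b i| `^ p) / be `^ p)))).
  apply: ler_sum => i _.
  have E : (al + be) * (al / (al + be) * (`|a i| / al) + be / (al + be) * (`|b i| / be))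
      = `|a i| + `|b i|.
    by field; rewrite alN0 beN0 lt0r_neq0.
  have ai : 0 <= `|a i| / al by rewrite divr_ge0.
  have bi : 0 <= `|b i| / be by rewrite divr_ge0.
  have wa : 0 <= al / (al + be) by rewrite divr_ge0// ltW.
  have wb : 0 <= be / (al + be) by rewrite divr_ge0// ltW.
  apply: (@le_trans _ _ ((`|a i| + `|b i|) `^ p)).
    by apply: ge0_ler_powR; rewrite ?nnegrE ?addr_ge0// ler_normD.
  rewrite -E powRM ?(ltW abp)//; last by rewrite addr_ge0// mulr_ge0.
  rewrite ler_pM2l ?powR_gt0//.
  have := powR_convex2 ai bi wa wb.
  rewrite -mulrDl mulfV ?lt0r_neq0// => /(_ erefl) /le_trans; apply.
  by rewrite !powR_quotient.
rewrite -mulr_sumr ler_piMr ?powR_ge0//.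
rewrite big_split/= -!mulr_sumr -!mulr_suml AE BE.
by rewrite !mulfV ?lt0r_neq0 ?powR_gt0// !mulr1 -mulrDl mulfV// lt0r_neq0.
Qed.

Lemma minkowski_seq (I : Type) (r : seq I) (a b : I -> R) :
  (\sum_(i <- r) `|a i + b i| `^ p) `^ p^-1 <=
  (\sum_(i <- r) `|a i| `^ p) `^ p^-1 + (\sum_(i <- r) `|b i| `^ p) `^ p^-1.
Proof.
have S0 (c : I -> R) : 0 <= \sum_(i <- r) `|c i| `^ p.
  by apply: sumr_ge0 => *; exact: powR_ge0.
set al := (X in _ <= X + _); set be := (X in _ <= _ + X).
have al0 : 0 <= al by exact: powR_ge0.
have be0 : 0 <= be by exact: powR_ge0.
rewrite -(powRK_inv (addr_ge0 al0 be0)); apply: ge0_ler_powR.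
- by rewrite invr_ge0.
- by rewrite nnegrE.
- by rewrite nnegrE powR_ge0.
by apply: minkowski_powR => //; rewrite powR_invK.
Qed.

End Minkowski.

(** * Norms of finitely supported functions on a group *)

Section PNorm.
Variables (R : realType) (p : R) (G : groupType).
Hypothesis hp : 1 <= p.
Implicit Types f h : G -> R.

Let p_gt0 : 0 < p. Proof. exact: lt_le_trans hp. Qed.
Let p_neq0 : p != 0. Proof. exact: lt0r_neq0. Qed.

Definition fsupp f := finite_set [set g | f g != 0].

Lemma pnorm_fset f (A : {fset G}) : (forall g, f g != 0 -> g \in A) ->
  pnorm p f = (\sum_(g <- A) `|f g| `^ p) `^ p^-1.
Proof.
move=> fA; rewrite /pnorm (@fsbigTE _ _ _ _ A)// => g gA.
suff -> : f g = 0 by rewrite normr0 powR0.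
by apply/eqP; apply: contraNT gA; exact: fA.
Qed.

Lemma fsuppP f : fsupp f -> exists A : {fset G}, forall g, f g != 0 -> g \in A.
Proof.
by move=> fs; exists (fset_set [set g | f g != 0]) => g fg; rewrite in_fset_set// inE.
Qed.

Lemma fsupp_fset f (A : {fset G}) : (forall g, f g != 0 -> g \in A) -> fsupp f.
Proof. by move=> fA; apply: (sub_finite_set _ (finite_fset A)) => g /fA. Qed.

Lemma fsuppD f h : fsupp f -> fsupp h -> fsupp (fun g => f g + h g).
Proof.
move=> /fsuppP[A fA] /fsuppP[B hB]; apply: (@fsupp_fset _ (A `|` B)%fset) => g.
rewrite in_fsetU; apply: contraR; rewrite negb_or => /andP[/negP gA /negP gB].
have -> : f g = 0 by apply/eqP/negPn/negP => /fA.
by have -> : h g = 0 by [apply/eqP/negPn/negP => /hB]; rewrite addr0.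
Qed.

Lemma fsupp_sub f h : (forall g, h g != 0 -> f g != 0) -> fsupp f -> fsupp h.
Proof. by move=> fh; apply: sub_finite_set => g /fh. Qed.

Lemma fsuppN f : fsupp f -> fsupp (fun g => - f g).
Proof. by apply: fsupp_sub => g; rewrite oppr_eq0. Qed.

Lemma fsuppB f h : fsupp f -> fsupp h -> fsupp (fun g => f g - h g).
Proof. by move=> ff fh; apply: fsuppD => //; exact: fsuppN. Qed.

Lemma mulg_bij (t : G) : bijective (fun g : G => (t * g)%g).
Proof. by exists (fun g => (t^-1 * g)%g) => g; rewrite ?mulKg ?mulVKg. Qed.

Lemma fsupp_translate f (t : G) : fsupp f -> fsupp (fun g => f (t * g)%g).
Proof.
move=> ff; rewrite /fsupp.
have -> : [set g | f (t * g)%g != 0] =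
    (fun g => t^-1 * g)%g @` [set g | f g != 0].
  apply/seteqP; split => [g /= fg|_ [g /= fg <-]]; last by rewrite mulVKg.
  by exists (t * g)%g => //; rewrite mulKg.
exact: finite_image.
Qed.

Lemma pnorm_ge0 f : 0 <= pnorm p f. Proof. exact: powR_ge0. Qed.

Lemma pnorm_translate f (t : G) : pnorm p (fun g => f (t * g)%g) = pnorm p f.
Proof.
rewrite /pnorm; congr (_ `^ _).
by rewrite [RHS](reindex_fsbigT (fun g => t * g)%g)//; exact: mulg_bij.
Qed.

Lemma pnormD f h : fsupp f -> fsupp h ->
  pnorm p (fun g => f g + h g) <= pnorm p f + pnorm p h.
Proof.
move=> /fsuppP[A fA] /fsuppP[B hB].
rewrite !(@pnorm_fset _ (A `|` B)%fset); last 3 first.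
- by move=> g /hB gB; rewrite in_fsetU gB orbT.
- by move=> g /fA gA; rewrite in_fsetU gA.
- move=> g; rewrite in_fsetU; apply: contraR.
  rewrite negb_or => /andP[/negP gA /negP gB].
  have -> : f g = 0 by apply/eqP/negPn/negP => /fA.
  by have -> : h g = 0 by [apply/eqP/negPn/negP => /hB]; rewrite addr0.
exact: minkowski_seq.
Qed.

Lemma pnormN f : pnorm p (fun g => - f g) = pnorm p f.
Proof. by rewrite /pnorm; under eq_fsbigr do rewrite normrN. Qed.

Lemma pnorm_dist f h : fsupp f -> fsupp h ->
  `|pnorm p f - pnorm p h| <= pnorm p (fun g => f g - h g).
Proof.
move=> ff fh; rewrite ler_norml; apply/andP; split.
  rewrite lerNl opprB lerBlDr -(pnormN (fun g => f g - h g)).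
  have := @pnormD (fun g => - (f g - h g)) f (fsuppN (fsuppB ff fh)) ff.
  suff -> : (fun g => - (f g - h g) + f g) = h by [].
  by apply/funext => g; rewrite opprB subrK.
rewrite lerBlDr.
have := @pnormD (fun g => f g - h g) h (fsuppB ff fh) fh.
suff -> : (fun g => f g - h g + h g) = f by [].
by apply/funext => g; rewrite subrK.
Qed.

(** Bridge from the finite sums defining the norms to extended nonnegative sums, which can be
    reordered and integrated without summability conditions. *)
Lemma fsum_esum (I : choiceType) (a : I -> R) :
  finite_set [set i | a i != 0] -> (forall i, 0 <= a i) ->
  ((\sum_(i \in [set: I]) a i)%:E = \esum_(i in [set: I]) (a i)%:E)%E.
Proof.
move=> fa a0; have -> : \esum_(i in [set: I]) (a i)%:E = \esum_(i in [set i | a i != 0]) (a i)%:E.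
  rewrite [RHS]esum_mkcond; apply: eq_esum => i _.
  by case: ifPn => //; rewrite notin_setE/= => /negP/negPn/eqP ->.
rewrite esum_fset//; last by move=> i _; rewrite lee_fin.
rewrite fsumEFin//; congr EFin.
apply/esym/fsbig_widen => // i [_ /= /negP/negPn/eqP //].
Qed.

Lemma pnorm_powR f : (pnorm p f) `^ p = \sum_(g \in [set: G]) `|f g| `^ p.
Proof. by rewrite powR_invK// fsumr_ge0// => *; exact: powR_ge0. Qed.

Lemma pnorm_esum f : fsupp f ->
  (((pnorm p f) `^ p)%:E = \esum_(g in [set: G]) (`|f g| `^ p)%:E)%E.
Proof.
move=> ff; rewrite pnorm_powR fsum_esum//.
apply: sub_finite_set ff => g /=; apply: contra => /eqP ->.
by rewrite normr0 powR0.
Qed.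

Lemma pnorm_gt0 f g : fsupp f -> f g != 0 -> 0 < pnorm p f.
Proof.
move=> ff fg; rewrite lt_def pnorm_ge0 andbT; apply/eqP => f0.
have := pnorm_esum ff; rewrite f0 powR0// => /esym e0.
have : ((`|f g| `^ p)%:E <= 0%:E)%E.
  rewrite -e0; apply: esum_ge; exists [set g]; first by split.
  by rewrite fsbig_set1.
by rewrite lee_fin leNgt powR_gt0// normr_gt0.
Qed.

Lemma pnorm_le_esum f (C : R) : fsupp f -> 0 <= C ->
  (\esum_(g in [set: G]) (`|f g| `^ p)%:E <= C%:E)%E -> pnorm p f <= C `^ p^-1.
Proof.
move=> ff C0; rewrite -pnorm_esum// lee_fin => h.
rewrite -(powRK_inv hp (pnorm_ge0 f)).
by apply: ge0_ler_powR; rewrite ?nnegrE ?powR_ge0// invr_ge0 ltW.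
Qed.

(** * The gradient norm and displacement along words *)

Section Gradient.
Variable S : set G.
Hypothesis finS : finite_set S.

Lemma grad_pnorm_ge0 f : 0 <= grad_pnorm p S f. Proof. exact: powR_ge0. Qed.

Lemma grad_pnorm_esum f : fsupp f ->
  (((grad_pnorm p S f) `^ p)%:E =
    \esum_(g in [set: G]) \esum_(s in S) (`|f (s * g)%g - f g| `^ p)%:E)%E.
Proof.
move=> ff; rewrite powR_invK//; last first.
  by apply: fsumr_ge0 => g _; apply: fsumr_ge0 => s _; exact: powR_ge0.
rewrite fsum_esum; last 2 first.
- have fin : finite_set (\bigcup_(s in S) [set g | f (s * g)%g - f g != 0]).
    apply: bigcup_finite => // s _.
    by apply: fsuppB => //; exact: fsupp_translate.
  apply: (sub_finite_set _ fin) => g /= /eqP ne; apply: contrapT => /forall2NP h.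
  apply: ne; rewrite fsbig1// => s Ss; case: (h s) => // /negP/negPn/eqP ->.
  by rewrite normr0 powR0.
- by move=> g; apply: fsumr_ge0 => s _; exact: powR_ge0.
by apply: eq_esum => g _; rewrite esum_fset// fsumEFin.
Qed.

Lemma pnorm_grad_gen f s : fsupp f -> S s ->
  pnorm p (fun g => f (s * g)%g - f g) <= grad_pnorm p S f.
Proof.
move=> ff Ss; rewrite -(powRK_inv hp (grad_pnorm_ge0 f)).
apply: pnorm_le_esum.
- by apply: fsuppB => //; exact: fsupp_translate.
- exact: powR_ge0.
rewrite grad_pnorm_esum//; apply: le_esum => g _.
apply: esum_ge; exists [set s]; first by split => // _ ->.
by rewrite fsbig_set1.
Qed.

(** Telescoping along the word: each letter contributes a translate of one generator difference, and
    translation preserves the norm. *)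
Lemma pnorm_grad_word f (w : seq G) : fsupp f -> [set` w] `<=` S ->
  pnorm p (fun g => f ((\prod_(s <- w) s) * g)%g - f g) <=
    (size w)%:R * grad_pnorm p S f.
Proof.
move=> ff; elim: w => [_|s w IH wS].
  rewrite mul0r /pnorm fsbig1 ?powR0 ?invr_eq0// => g _.
  by rewrite big_nil mul1g subrr normr0 powR0.
have Ss : S s by apply: wS; rewrite /= mem_head.
have {}IH := IH (fun x xw => wS x (mem_behead (s := s :: w) xw)).
set t := (\prod_(s <- w) s)%g in IH *.
rewrite big_cons -/t -natr1 mulrDl mul1r addrC.
have f1 := fsuppB (fsupp_translate t (fsupp_translate s ff)) (fsupp_translate t ff).
have f2 := fsuppB (fsupp_translate t ff) ff.
have := pnormD f1 f2.
rewrite (_ : (fun g => _ + _) = (fun g => f (s * t * g)%g - f g)); last first.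
  by apply/funext => g; rewrite mulgA addrA subrK.
move=> /le_trans; apply; apply: lerD => //.
rewrite (pnorm_translate (fun g => f (s * g)%g - f g) t).
exact: pnorm_grad_gen.
Qed.

End Gradient.

End PNorm.

Lemma symgen_countable (G : groupType) (S : set G) :
  symmetric_generating_set S -> countable [set: G].
Proof.
move=> [/finite_seqP[s ->] _ gen].
pose word (v : seq nat) : G := (\prod_(i <- v) nth 1 s i)%g.
apply: (@sub_countable _ _ _ (range word)); last first.
  by apply: (sub_countable (card_image_le _ _)); exact: countableP.
apply: subset_card_le => g _; have [w ws ->] := gen g.
exists (map (index^~ s) w) => //; rewrite /word big_map.
apply: eq_big_seq => x xw; rewrite nth_index//; exact: (ws x).
Qed.

(** * Sums over a countable index and their integrals *)

Section CountableSums.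
Variables (R : realType) (I : choiceType).
Hypothesis cI : countable [set: I].
Local Open Scope ereal_scope.

(** The enumeration [h] does not depend on [a], so a single one turns a whole family of sums, such
    as one for each point of a measure space, into series. *)
Lemma esum_countable : exists h : nat -> option I,
  forall a : I -> \bar R, (forall i, 0 <= a i) ->
    \esum_(i in [set: I]) a i = \sum_(n <oo) oapp a 0 (h n).
Proof.
have [f finj] := countable_injP _ cI.
have {}finj i j : f i = f j -> i = j by apply: finj; rewrite inE.
(* An [n] outside the range of [f] receives the default [None], which contributes 0 to the
   series. *)
pose P n := [set o : option I | exists i, o = Some i /\ f i = n].
pose h n := xget None (P n); exists h => a a0.
have hf i : h (f i) = Some i.
  rewrite /h; case: xgetP => [q _ [j [-> /finj ->]] // | no].
  by case: (no (Some i)); exists i.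
rewrite nneseries_esumT => [|n]; last by case: (h n) => /=.
have -> : \esum_(i in [set: I]) a i = \esum_(i in [set: I]) oapp a 0 (h (f i)).
  by apply: eq_esum => i _; rewrite hf.
rewrite -(esum_image [set: I] f (fun n => oapp a 0 (h n))) => [|i j _ _]; last exact: finj.
rewrite esum_mkcond; apply: eq_esum => n _; case: ifPn => //.
rewrite notin_setE => nf; rewrite /h; case: xgetP => //= o _ [i [_ fi]].
by case: nf; exists i.
Qed.

Variables (d : measure_display) (T : measurableType d).
Variable mu : {measure set T -> \bar R}.

Lemma measurable_esum (D : set T) (f : I -> T -> \bar R) :
  (forall i, measurable_fun D (f i)) -> (forall i x, 0 <= f i x) ->
  measurable_fun D (fun x => \esum_(i in [set: I]) f i x).
Proof.
move=> mf f0; have [h hE] := esum_countable.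
under eq_fun do rewrite hE//.
rewrite (_ : (fun _ => _) =
   (fun x => \sum_(n <oo | n \in predT) oapp (fun i => f i x) 0 (h n))); last first.
  by apply/funext => x; apply: eq_eseriesl.
apply: ge0_emeasurable_sum => [n x _ _|n _].
- by case: (h n) => /=.
- by case: (h n) => [i|] /=; [exact: mf|exact: measurable_cst].
Qed.

Lemma integral_esum (D : set T) (f : I -> T -> \bar R) : measurable D ->
  (forall i, measurable_fun D (f i)) -> (forall i x, 0 <= f i x) ->
  \int[mu]_(x in D) (\esum_(i in [set: I]) f i x) =
    \esum_(i in [set: I]) \int[mu]_(x in D) f i x.
Proof.
move=> mD mf f0; have [h hE] := esum_countable.
under eq_integral do rewrite hE//.
rewrite integral_nneseries//; first last.
- by move=> n x _; case: (h n) => /=.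
- by move=> n; case: (h n) => [i|] /=; [exact: mf|exact: measurable_cst].
rewrite hE => [|i]; last by apply: integral_ge0 => x _.
apply: eq_eseriesr => n _; case: (h n) => //=.
by rewrite integral0.
Qed.

Lemma bigcup_null (F : I -> set T) :
  (forall i, mu.-negligible (F i)) -> mu.-negligible (\bigcup_i F i).
Proof.
move=> F0; have [f finj] := countable_injP _ cI.
apply: (@negligibleS _ _ _ mu (\bigcup_n \bigcup_(i in [set i | f i = n]) F i)).
  by move=> x [i _ Fix]; exists (f i) => //; exists i.
apply: negligible_bigcup => n.
have [[i fi]|no] := pselect (exists i, f i = n).
- apply: negligibleS (F0 i) => x [j fj Fjx].
  by rewrite (_ : i = j)//; apply: finj; rewrite ?inE// fi fj.
- by rewrite bigcup0 => [|i fi]; [exact: negligible_set0|case: no; exists i].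
Qed.

End CountableSums.

(** Measurability is not assumed: the integral of a nonnegative function is a supremum over the
    simple functions below it, hence monotone. This serves for the orbit distance, whose
    measurability is not established. *)
Lemma ge0_le_lower_integral (R : realType) (d : measure_display)
    (T : measurableType d) (mu : {measure set T -> \bar R}) (A B : set T)
    (f g : T -> \bar R) :
  A `<=` B -> (forall x, 0 <= f x)%E -> (forall x, 0 <= g x)%E ->
  (forall x, A x -> f x <= g x)%E ->
  (\int[mu]_(x in A) f x <= \int[mu]_(x in B) g x)%E.
Proof.
move=> AB f0 g0 fg; rewrite !ge0_integralE//.
apply: le_ereal_sup => _ [h hf <-]; exists h => // x; apply: le_trans (hf x) _.
rewrite !patchE; case: ifPn => [xA|_]; last by case: ifPn.
by rewrite ifT ?fg//; move: xA; rewrite !inE//; exact: AB.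
Qed.

(** * Rearranging and comparing nonnegative sums *)

Section EsumFacts.
Variable R : realType.
Local Open Scope ereal_scope.

Lemma esum_single (I : choiceType) (i0 : I) (a : I -> \bar R) :
  0 <= a i0 -> (forall i, i <> i0 -> a i = 0) ->
  \esum_(i in [set: I]) a i = a i0.
Proof.
move=> a0 ai; rewrite -[RHS](esum_set1 a0) [RHS]esum_mkcond.
apply: eq_esum => i _; case: ifPn => //; rewrite notin_setE => /= ii0.
exact: ai.
Qed.

Lemma exchange_esum (I J : choiceType) (a : I -> J -> \bar R) :
  (forall i j, 0 <= a i j) ->
  \esum_(i in [set: I]) \esum_(j in [set: J]) a i j =
    \esum_(j in [set: J]) \esum_(i in [set: I]) a i j.
Proof.
move=> a0; rewrite !esum_esum//.
rewrite (reindex_esum ([set: J] `*`` (fun=> [set: I])) _ (fun k => (k.2, k.1)))//.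
split => //; first by move=> [j1 i1] [j2 i2] _ _ /= [-> ->].
by move=> [i j] _; exists (j, i).
Qed.

Lemma esum_pair (I J : choiceType) (a : I -> J -> \bar R) :
  (forall i j, 0 <= a i j) ->
  \esum_(i in [set: I]) \esum_(j in [set: J]) a i j =
    \esum_(k in [set: I * J]) a k.1 k.2.
Proof.
move=> a0; rewrite esum_esum//; congr (esum _ _).
by apply/seteqP; split.
Qed.

Lemma le_esum_inj (I J : choiceType) (e : I -> J) (a : J -> \bar R) :
  injective e -> (forall j, 0 <= a j) ->
  \esum_(i in [set: I]) a (e i) <= \esum_(j in [set: J]) a j.
Proof.
move=> inje a0; rewrite -(esum_image [set: I] e a) => [|i j _ _]; last exact: inje.
rewrite esum_mkcond; apply: le_esum => j _; by case: ifP.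
Qed.

Lemma ge0_esumZl (I : choiceType) (c : R) (a : I -> \bar R) :
  countable [set: I] -> (0 <= c)%R -> (forall i, 0 <= a i) ->
  \esum_(i in [set: I]) (c%:E * a i) = c%:E * \esum_(i in [set: I]) a i.
Proof.
move=> cI c0 a0; have [h hE] := esum_countable R cI.
rewrite !hE// => [|i]; last by rewrite mule_ge0.
rewrite -nneseriesZl//; last by move=> n _; case: (h n) => /=.
by apply: eq_eseriesr => n _; case: (h n) => //=; rewrite mule0.
Qed.

(** Every finite subset of [P] contributes at least its size to the sum, and an infinite [P] would
    contain a subset of size [K.+1]. *)
Lemma card_le_esum (I : choiceType) (P : set I) (K : nat) (a : I -> \bar R) :
  (forall i, 0 <= a i) -> (forall i, P i -> 1 <= a i) ->
  \esum_(i in [set: I]) a i <= K%:R%:E -> (P #<= `I_K)%card.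
Proof.
move=> a0 aP aK.
have card_le (A : {fset I}) : [set` A] `<=` P -> (size A <= K)%N.
  move=> AP; rewrite -(@ler_nat R) -lee_fin; apply: le_trans aK.
  apply: esum_ge; exists [set` A]; first by split.
  rewrite -fsbig_seq//; apply: (@le_trans _ _ (\sum_(i <- A) 1)).
    by rewrite sumEFin lee_fin big_const_seq count_predT iter_addr addr0.
  rewrite !big_seq; apply: lee_sum => i iA; exact/aP/AP.
have finP : finite_set P.
  apply: contrapT => /infinite_set_fset => /(_ K.+1)[A AP].
  by rewrite leqNgt ltnS card_le.
have /finite_setP[m Pm] := finP.
rewrite (card_le_eql Pm) card_le_II -(card_fset_set Pm).
by apply: card_le; rewrite fset_setK.
Qed.

End EsumFacts.
(** A coupling whose almost-everywhere properties hold everywhere on an invariant conull set [Om].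
    Freeness of [Gam] is encoded in [rc_D_inj], where the group element is unique; for [Lam], which
    may have stabilizers, [rc_X_inj] makes only the point of [X] unique. *)
Record reduced_coupling (R : realType) (Gam Lam : groupType)
    (d : measure_display) (T : measurableType d) (mu : {measure set T -> \bar R})
    (aG : Gam -> T -> T) (aL : Lam -> T -> T) (D X Om : set T) : Prop :=
  ReducedCoupling {
  rc_actionG : is_action aG;
  rc_actionL : is_action aL;
  rc_commute : forall g l x, aG g (aL l x) = aL l (aG g x);
  rc_preservingG : measure_preserving mu aG;
  rc_preservingL : measure_preserving mu aL;
  rc_measurable : measurable Om;
  rc_conull : mu (~` Om) = 0%E;
  rc_invariantG : forall g x, Om x -> Om (aG g x);
  rc_invariantL : forall l x, Om x -> Om (aL l x);
  rc_measurableD : measurable D;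
  rc_measurableX : measurable X;
  rc_subD : D `<=` Om;
  rc_subX : X `<=` Om;
  rc_D_ex : forall x, Om x -> exists g, D (aG g x);
  rc_D_inj : forall x g h, Om x -> D (aG g x) -> D (aG h x) -> g = h;
  rc_X_ex : forall x, Om x -> exists l, X (aL l x);
  rc_X_inj : forall x k l, X (aL k x) -> X (aL l x) -> aL k x = aL l x;
  rc_finite : (mu X < +oo)%E;
  rc_nonzero : mu X <> 0%E }.

Lemma action_inv_l (G : groupType) d (U : measurableType d) (a : G -> U -> U) g x :
  is_action a -> a g^-1%g (a g x) = x.
Proof. by move=> [a1 aM]; rewrite -aM mulVg. Qed.

Lemma action_inv_r (G : groupType) d (U : measurableType d) (a : G -> U -> U) g x :
  is_action a -> a g (a g^-1%g x) = x.
Proof. by move=> [a1 aM]; rewrite -aM mulgV. Qed.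

(** * Discarding an invariant null set *)

Section Reduction.
Variables (R : realType) (Gam Lam : groupType).
Variables (d : measure_display) (T : measurableType d).
Variable mu : {measure set T -> \bar R}.
Variables (aG : Gam -> T -> T) (aL : Lam -> T -> T) (X : set T).
Lemma measure_setI_conull (A Om : set T) : measurable A -> measurable Om ->
  mu (~` Om) = 0%E -> mu (A `&` Om) = mu A.
Proof.
move=> mA mOm Om0; rewrite [RHS](measureDI _ mA mOm).
rewrite [X in (X + _)%E](subset_measure0 _ (measurableC mOm)) ?add0e//.
exact: measurableD.
Qed.

Lemma measurable_preimage_action (G : groupType) (a : G -> T -> T) g (A : set T) :
  measure_preserving mu a -> measurable A -> measurable (a g @^-1` A).
Proof.
by move=> /(_ g)[ma _] mA; rewrite -[Y in measurable Y]setTI; exact: ma.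
Qed.

Lemma measure_preimage_action (G : groupType) (a : G -> T -> T) g (A : set T) :
  measure_preserving mu a -> measurable A -> mu (a g @^-1` A) = mu A.
Proof. by move=> /(_ g)[_]; exact. Qed.

Lemma preimage_negligible (G : groupType) (a : G -> T -> T) g (N : set T) :
  measure_preserving mu a -> measurable N -> mu N = 0%E ->
  mu.-negligible (a g @^-1` N).
Proof.
move=> pa mN N0; apply/negligibleP; first exact: measurable_preimage_action.
exact: (etrans (measure_preimage_action _ pa mN) N0).
Qed.

Hypothesis cG : countable [set: Gam].
Hypothesis cL : countable [set: Lam].

(** The exceptional sets for freeness and for the two fundamental domains are null; both groups
    being countable, the union of all their translates is still null, and its complement serves as
    [Om]. *)
Lemma reduction : subquotient_coupling mu aG aL X ->
  exists D Om, reduced_coupling mu aG aL D (X `&` Om) Om.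
Proof.
case=> _ _ nz aGa aLa cGL pG pL free [D0 [mD0 D0ae]] [mX Xae] Xfin.
have [N1 [mN1 N10 hN1]] := free.
have [N2 [mN2 N20 hN2]] := D0ae.
have [N3 [mN3 N30 hN3]] := Xae.
pose N := N1 `|` N2 `|` N3.
have mN : measurable N by apply: measurableU => //; exact: measurableU.
have N0 : mu N = 0%E.
  apply/negligibleP => //; apply: negligibleU; last exact/negligibleP.
  by apply: negligibleU; exact/negligibleP.
pose N' := \bigcup_(g : Gam) \bigcup_(l : Lam) (aG g @^-1` (aL l @^-1` N)).
have mN' : measurable N'.
  apply: countable_bigcupT_measurable => // g.
  apply: countable_bigcupT_measurable => // l.
  by do 2 apply: measurable_preimage_action => //.
have N'0 : mu N' = 0%E.
  apply: measure_negligible => //.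
  apply: (bigcup_null (I := Gam)) => // g; apply: (bigcup_null (I := Lam)) => // l.
  apply: preimage_negligible => //; first exact: measurable_preimage_action.
  exact: (etrans (measure_preimage_action _ pL mN) N0).
have invG g x : (~` N') x -> (~` N') (aG g x).
  move=> Nx [h _ [l _ /= Nl]]; apply: Nx; exists (h * g)%g => //; exists l => //=.
  by case: aGa => _ ->.
have invL l x : (~` N') x -> (~` N') (aL l x).
  move=> Nx [h _ [k _ /= Nl]]; apply: Nx; exists h => //; exists (k * l)%g => //=.
  by case: aLa => _ ->; rewrite -cGL.
have N'N x : (~` N') x -> ~ N x.
  move=> Nx Nx'; apply: Nx; exists 1%g => //; exists 1%g => //=.
  by case: aGa => -> _; case: aLa => ->.
have P1 x : (~` N') x -> forall g, aG g x = x -> g = 1%g.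
  move=> /N'N Nx; apply: contrapT => h; apply: Nx; left; left; exact: hN1.
have P2 x : (~` N') x -> exists y, action_orbit aG x `&` D0 = [set y].
  move=> /N'N Nx; apply: contrapT => h; apply: Nx; left; right; exact: hN2.
have P3 x : (~` N') x -> exists y, action_orbit aL x `&` X = [set y].
  move=> /N'N Nx; apply: contrapT => h; apply: Nx; right; exact: hN3.
(* The translates of [X] under [Lam] cover almost everything, so a null [X] would make [mu] zero. *)
have muX0 : mu X <> 0%E.
  move=> X0; apply: nz; rewrite -(setvU N').
  apply: measure_negligible; first by rewrite setvU.
  apply: negligibleU; last exact/negligibleP.
  apply: (negligibleS (A := \bigcup_(l : Lam) (aL l @^-1` X))).
    move=> x /P3[y xy]; have : [set y] y by [].
    by rewrite -xy => -[[l _ <-] Xl]; exists l.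
  by apply: (bigcup_null (I := Lam)) => // l; exact: preimage_negligible.
have XN : mu (X `&` ~` N') = mu X.
  by rewrite measure_setI_conull//; [exact: measurableC|rewrite setCK].
exists (D0 `&` ~` N'), (~` N').
split => //.
- exact: measurableC.
- by rewrite setCK.
- by apply: measurableI => //; exact: measurableC.
- by apply: measurableI => //; exact: measurableC.
- move=> x Nx; have [y xy] := P2 x Nx; have : [set y] y by [].
  rewrite -xy => -[[g _ <-] Dg]; exists g; split => //; exact: invG.
- move=> x g h Nx [Dg _] [Dh _]; have [y xy] := P2 x Nx.
  have gy : [set y] (aG g x) by rewrite -xy; split => //; exists g.
  have hy : [set y] (aG h x) by rewrite -xy; split => //; exists h.
  (* The domain property only identifies the points g*x and h*x; freeness upgrades this to g = h. *)
  have : aG (h^-1 * g)%g x = x.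
    by case: (aGa) => _ ->; rewrite gy -hy action_inv_l.
  by move=> /(P1 x Nx) E; rewrite -(mulVKg h g) E mulg1.
- move=> x Nx; have [y xy] := P3 x Nx; have : [set y] y by [].
  rewrite -xy => -[[l _ <-] Xl]; exists l; split => //; exact: invL.
- move=> x k l [Xk Nk] [Xl _].
  have Nx : (~` N') x by rewrite -(action_inv_l k x aLa); exact: invL.
  have [y xy] := P3 x Nx.
  have gy : [set y] (aL k x) by rewrite -xy; split => //; exists k.
  have hy : [set y] (aL l x) by rewrite -xy; split => //; exists l.
  by rewrite gy hy.
- by rewrite [X in (X < _)%E]XN.
- by rewrite XN.
Qed.

End Reduction.

(** * Unfolding over a fundamental domain, and multiplicity of orbits *)

Section Transport.
Variables (R : realType) (Gam Lam : groupType).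
Variables (d : measure_display) (T : measurableType d).
Variable mu : {measure set T -> \bar R}.
Variables (aG : Gam -> T -> T) (aL : Lam -> T -> T) (D X Om : set T).
Hypothesis cG : countable [set: Gam].
Hypothesis H : reduced_coupling mu aG aL D X Om.
Local Open Scope ereal_scope.

Let mD : measurable D := rc_measurableD H.
Let mX : measurable X := rc_measurableX H.
Let mOm : measurable Om := rc_measurable H.

Lemma measure_setIOm A : measurable A -> mu (A `&` Om) = mu A.
Proof. by move=> mA; apply: measure_setI_conull => //; exact: rc_conull H. Qed.

Lemma measurable_actG g E : measurable E -> measurable (aG g @^-1` E).
Proof. exact: measurable_preimage_action (rc_preservingG H). Qed.

Lemma measurable_actL l E : measurable E -> measurable (aL l @^-1` E).
Proof. exact: measurable_preimage_action (rc_preservingL H). Qed.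

Lemma measure_actG g E : measurable E -> mu (aG g @^-1` E) = mu E.
Proof. exact: measure_preimage_action (rc_preservingG H). Qed.

Lemma measure_actL l E : measurable E -> mu (aL l @^-1` E) = mu E.
Proof. exact: measure_preimage_action (rc_preservingL H). Qed.

Lemma esum_indic_domain E y : Om y ->
  \esum_(g in [set: Gam]) (\1_(E `&` aG g^-1%g @^-1` D) y)%:E = (\1_E y)%:E :> \bar R.
Proof.
move=> Oy; have [g0 Dg0] := rc_D_ex H Oy.
rewrite (esum_single (i0 := g0^-1%g)).
- by rewrite !indicE in_setI [X in _ && X]mem_set ?andbT//= invgK.
- by rewrite lee_fin.
move=> g gg0; rewrite indicE memNset// => -[_ /= Dg]; apply: gg0.
by rewrite -(rc_D_inj H Oy Dg Dg0) invgK.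
Qed.

(** The translates of [D] tile [Om]. Cutting [E] along this tiling and moving each piece back into
    [D] preserves measure. *)
Lemma transport E : measurable E ->
  \esum_(g in [set: Gam]) mu (D `&` aG g @^-1` E) = mu E.
Proof.
move=> mE.
have mDg g : measurable (E `&` aG g^-1%g @^-1` D).
  by apply: measurableI => //; exact: measurable_actG.
transitivity (\esum_(g in [set: Gam]) \int[mu]_(x in Om) (\1_(E `&` aG g^-1%g @^-1` D) x)%:E).
  apply: eq_esum => g _; rewrite integral_indic// measure_setIOm//.
  rewrite -[LHS](measure_actG g^-1%g); last first.
    by apply: measurableI => //; exact: measurable_actG.
  congr (mu _); apply/seteqP; split => [x [/= Dx Ex]|x [/= Ex Dx]]; split => //=.
    by move: Ex; rewrite (action_inv_r _ _ (rc_actionG H)).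
  by rewrite (action_inv_r _ _ (rc_actionG H)).
rewrite -integral_esum//; last first.
  by move=> g; apply/measurable_EFinP; exact: measurable_indic.
rewrite (eq_integral (fun x => (\1_E x)%:E)); last first.
  by move=> x /set_mem xOm; exact: esum_indic_domain.
by rewrite integral_indic// measure_setIOm.
Qed.

Lemma measurable_summand (c : R) l g E : measurable E ->
  measurable_fun D (fun x => (c * \1_E (aL l (aG g x)))%:E).
Proof.
move=> mE; apply/measurable_EFinP; apply: measurable_funM => //.
rewrite (_ : (fun x => _) = \1_(aG g @^-1` (aL l @^-1` E))); last first.
  by apply/funext => x; rewrite !indicE.
by apply: measurable_indic; apply: measurable_actG; exact: measurable_actL.
Qed.

Lemma transport_indic (c : R) l E : (0 <= c)%R -> measurable E ->
  \int[mu]_(x in D) (\esum_(g in [set: Gam]) (c * \1_E (aL l (aG g x)))%:E) =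
    c%:E * mu E.
Proof.
move=> c0 mE; rewrite integral_esum//; last 2 first.
- by move=> g; exact: measurable_summand.
- by move=> g x; rewrite lee_fin mulr_ge0.
have mE' : measurable (aL l @^-1` E) by exact: measurable_actL.
rewrite -(measure_actL l mE) -(transport mE') -ge0_esumZl//.
apply: eq_esum => g _.
have mE'' : measurable (aG g @^-1` (aL l @^-1` E)) by exact: measurable_actG.
under eq_integral do rewrite EFinM.
rewrite ge0_integralZl//; first by rewrite setIC -integral_indic.
apply/measurable_EFinP.
rewrite (_ : (fun x => _) = \1_(aG g @^-1` (aL l @^-1` E))); last first.
  by apply/funext => x; rewrite !indicE.
exact: measurable_indic.
Qed.

(** Common form of the three averages over [D]: norm, support and gradient. The shifts [l j]
    disappear because [Lam] preserves [mu]. *)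
Lemma transport_sum (J : choiceType) (c : J -> R) (l : J -> Lam) (E : J -> set T) :
  countable [set: J] -> (forall j, (0 <= c j)%R) -> (forall j, measurable (E j)) ->
  \int[mu]_(x in D) (\esum_(j in [set: J]) \esum_(g in [set: Gam])
      (c j * \1_(E j) (aL (l j) (aG g x)))%:E) =
    \esum_(j in [set: J]) (c j)%:E * mu (E j).
Proof.
move=> cJ c0 mE; rewrite integral_esum//.
- by apply: eq_esum => j _; rewrite transport_indic.
- move=> j; apply: measurable_esum => // [g|g x]; first exact: measurable_summand.
  by rewrite lee_fin mulr_ge0.
- by move=> j x; apply: esum_ge0 => g _; rewrite lee_fin mulr_ge0.
Qed.

Lemma measurable_transport_sum (J : choiceType) (c : J -> R) (l : J -> Lam)
    (E : J -> set T) :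
  countable [set: J] -> (forall j, (0 <= c j)%R) -> (forall j, measurable (E j)) ->
  measurable_fun D (fun x => \esum_(j in [set: J]) \esum_(g in [set: Gam])
      (c j * \1_(E j) (aL (l j) (aG g x)))%:E).
Proof.
move=> cJ c0 mE; apply: measurable_esum => // [j|j x].
- apply: measurable_esum => // [g|g x]; first exact: measurable_summand.
  by rewrite lee_fin mulr_ge0.
- by apply: esum_ge0 => g _; rewrite lee_fin mulr_ge0.
Qed.

(** Group elements are counted; on [Om], where the action of [Gam] is free, this is the number of
    points of [X] in the orbit. *)
Definition multiplicity (x : T) : \bar R :=
  \esum_(g in [set: Gam]) (\1_X (aG g x))%:E.

Definition bounded_part (M : nat) : set T :=
  X `&` [set x | multiplicity x <= M%:R%:E].

Lemma multiplicity_ge0 x : 0 <= multiplicity x.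
Proof. by apply: esum_ge0 => g _; rewrite lee_fin. Qed.

Lemma multiplicity_act g x : multiplicity (aG g x) = multiplicity x.
Proof.
rewrite /multiplicity [RHS](reindex_esum [set: Gam] _ (fun h => (h * g)%g)).
  by apply: eq_esum => h _; have [_ ->] := rc_actionG H.
split => //; first by move=> h k _ _; exact: mulIg.
by move=> h _; exists (h * g^-1)%g => //; rewrite -mulgA mulVg mulg1.
Qed.

Lemma measurable_multiplicity : measurable_fun [set: T] multiplicity.
Proof.
apply: measurable_esum => // g.
apply/measurable_EFinP.
rewrite (_ : (fun x => _) = \1_(aG g @^-1` X)); last first.
  by apply/funext => x; rewrite !indicE.
by apply: measurable_indic; exact: measurable_actG.
Qed.

Lemma measurable_bounded_part M : measurable (bounded_part M).
Proof.
apply: measurableI => //.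
rewrite -[Y in measurable Y]setTI.
exact: (emeasurable_fun_infty_c measurableT measurable_multiplicity).
Qed.

Lemma measurable_multiplicity_pinfty : measurable [set x | multiplicity x = +oo].
Proof.
rewrite -[Y in measurable Y]setTI.
exact: (measurable_multiplicity measurableT (emeasurable_set1 +oo)).
Qed.

(** By unfolding, the multiplicity has integral [mu X] over [D], which is finite, so it is finite
    almost everywhere on [D]; its invariance under [Gam] carries this to [X]. *)
Lemma multiplicity_finite_negl : mu (X `&` [set x | multiplicity x = +oo]) = 0.
Proof.
have mI := measurable_multiplicity_pinfty.
have int : \int[mu]_(x in D) multiplicity x = mu X.
  rewrite -[RHS]mul1e -(transport_indic 1%g ler01 mX).
  apply: eq_integral => x _; apply: eq_esum => g _.
  by have [-> _] := rc_actionL H; rewrite mul1r.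
have mmD : measurable_fun D multiplicity.
  exact: measurable_funS measurable_multiplicity.
have null : mu (D `&` [set x | multiplicity x = +oo]) = 0.
  have : mu.-integrable D multiplicity.
    apply/integrableP; split => //.
    under eq_integral do rewrite gee0_abs ?multiplicity_ge0//.
    by rewrite int; exact: rc_finite H.
  move=> /integrable_ae => /(_ mD)[N [mN N0 hN]].
  apply: (subset_measure0 _ mN) => //; first exact: measurableI.
  by move=> x [Dx /= xoo]; apply: hN => /= /(_ Dx); rewrite xoo.
rewrite -transport; last exact: measurableI.
rewrite esum1// => g _.
apply: (subset_measure0 _ _ _ null).
- by apply: measurableI => //; apply: measurable_actG; exact: measurableI.
- exact: measurableI.
- by move=> x [Dx [/= _]]; rewrite multiplicity_act.
Qed.

(** Continuity from below: the bounded parts increase to [X] up to a null set. If all those with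
    [0 < M] had less than half the measure, so would [X] up to equality, which is impossible as
    [mu X] is positive and finite. *)
Lemma bounded_part_large :
  exists M : nat, (0 < M)%N /\ (2^-1)%:E * mu X <= mu (bounded_part M).
Proof.
have mono : nondecreasing_seq bounded_part.
  move=> n m nm; apply/subsetPset => x [Xx /= k]; split => //=.
  by apply: (le_trans k); rewrite lee_fin ler_nat.
have mU : measurable (\bigcup_n bounded_part n).
  by apply: bigcupT_measurable => n; exact: measurable_bounded_part.
have muU : mu (\bigcup_n bounded_part n) = mu X.
  have XU : X = \bigcup_n bounded_part n `|` (X `&` [set x | multiplicity x = +oo]).
    apply/seteqP; split => [x Xx|x [[n _ []]|[]]] //.
    have [koo|kfin] := eqVneq (multiplicity x) +oo; first by right.
    left; exists (Num.truncn (fine (multiplicity x))).+1 => //; split => //=.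
    have kx : multiplicity x \is a fin_num.
      by rewrite ge0_fin_numE ?multiplicity_ge0// ltey.
    by rewrite -(fineK kx) lee_fin ltW// truncnS_gt.
  rewrite [in RHS]XU measureU0//; last exact: multiplicity_finite_negl.
  by apply: measurableI => //; exact: measurable_multiplicity_pinfty.
have cvg : mu \o bounded_part @ \oo --> mu X.
  by rewrite -muU; apply: nondecreasing_cvg_mu => //; exact: measurable_bounded_part.
apply: contrapT => h.
have lt M : (0 < M)%N -> mu (bounded_part M) <= (2^-1)%:E * mu X.
  by move=> M0; rewrite leNgt; apply/negP => /ltW lt; apply: h; exists M.
have : mu X <= (2^-1)%:E * mu X.
  rewrite -{1}(cvg_lim _ cvg)//; apply: lime_le; first by apply/cvg_ex; exists (mu X).
  by near=> M; apply: lt; near: M; exact: nbhs_infty_gt.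
have Xfin : mu X \is a fin_num by rewrite ge0_fin_numE//; exact: rc_finite H.
have X0 : (0 < fine (mu X))%R.
  rewrite lt0r fine_ge0// andbT; apply/eqP => X0.
  by apply: (rc_nonzero H); rewrite -(fineK Xfin) X0.
rewrite -(fineK Xfin) -EFinM lee_fin leNgt => /negP; apply.
by rewrite gtr_pMl// invf_lt1// ltr1n.
Unshelve. all: by end_near. Qed.

End Transport.

(** * Word length and an ordering refining it *)

Lemma word_length (G : groupType) (S : set G) : symmetric_generating_set S ->
  exists len : G -> nat,
    (forall g, exists w : seq G,
      [/\ [set` w] `<=` S, size w = len g & g = (\prod_(s <- w) s)%g]) /\
    (forall w : seq G, [set` w] `<=` S -> (len (\prod_(s <- w) s)%g <= size w)%N).
Proof.
move=> [_ _ gen].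
pose P (g : G) n := exists w : seq G,
  [/\ [set` w] `<=` S, size w = n & g = (\prod_(s <- w) s)%g].
have minP g : exists n, P g n /\ forall m, P g m -> (n <= m)%N.
  have [w wS gE] := gen g.
  have ex : exists n, `[< P g n >] by exists (size w); apply/asboolP; exists w.
  by case: (ex_minnP ex) => n /asboolP Pn min; exists n; split => // m /asboolP/min.
have [len lenP] := choice minP.
exists len; split => [g|w wS]; first by have [] := lenP g.
by have [_] := lenP (\prod_(s <- w) s)%g; apply; exists w.
Qed.

(** [e] is a tie-breaker: once it is injective, any two distinct elements are comparable and a first
    element is unique. *)
Definition lex_lt (I : Type) (len e : I -> nat) (i j : I) : bool :=
  ((len i < len j) || ((len i == len j) && (e i < e j)))%N.

Lemma lex_min (I : Type) (len e : I -> nat) (P : I -> Prop) :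
  (exists i, P i) -> exists2 i, P i & forall j, lex_lt len e j i -> ~ P j.
Proof.
move=> [i0 Pi0].
have ex1 : exists n, `[< exists2 i, P i & len i = n >].
  by exists (len i0); apply/asboolP; exists i0.
case: (ex_minnP ex1) => n /asboolP[i1 Pi1 li1] min1.
have ex2 : exists k, `[< exists i, [/\ P i, len i = n & e i = k] >].
  by exists (e i1); apply/asboolP; exists i1.
case: (ex_minnP ex2) => k /asboolP[i [Pi li ei]] min2.
exists i => // j /orP[lt|/andP[/eqP eq lt]] Pj.
  have : (n <= len j)%N by apply: min1; apply/asboolP; exists j.
  by rewrite -li leqNgt lt.
have : (k <= e j)%N by apply: min2; apply/asboolP; exists j; split => //; rewrite eq.
by rewrite -ei leqNgt lt.
Qed.

Lemma lex_lt_total (I : Type) (len e : I -> nat) (i j : I) :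
  injective e -> i <> j -> lex_lt len e i j \/ lex_lt len e j i.
Proof.
move=> einj ij; rewrite /lex_lt.
case: (ltngtP (len i) (len j)) => _ /=; [by left|by right|].
by case: (ltngtP (e i) (e j)) => [_|_|/einj //]; [left|right].
Qed.

(** * Measurable choice of the element realising the displacement *)

Section Displacement.
Variables (R : realType) (p : R) (Gam Lam : groupType) (SL : set Lam).
Hypothesis hp : 1 <= p.
Hypothesis hSL : symmetric_generating_set SL.
Variables (d : measure_display) (T : measurableType d).
Variable mu : {measure set T -> \bar R}.
Variables (aG : Gam -> T -> T) (aL : Lam -> T -> T) (D X Om : set T).
Hypothesis H : reduced_coupling mu aG aL D (X `&` Om) Om.
Hypothesis Lp : Lp_coupling mu aG aL X p SL.
Let p_ge0 : 0 <= p. Proof. exact: le_trans hp. Qed.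
Let Y := X `&` Om.
Let cL : countable [set: Lam] := symgen_countable hSL.

(* W s t is the set of x in X for which t is the first group element, in an
   ordering refining word length, taking s.x to s*x; choosing t this way makes
   it measurable in x without measurability of the orbit distance. *)
Lemma displacement_cells : exists (len : Lam -> nat) (W : Gam -> Lam -> set T),
  [/\ forall t, exists w : seq Lam,
        [/\ [set` w] `<=` SL, size w = len t & t = (\prod_(s <- w) s)%g],
      forall s t, measurable (W s t),
      forall s t x, W s t x -> Y (aL t^-1%g (aG s x)),
      forall s x, Y x -> exists t, W s t x &
      forall s, (\esum_(t in [set: Lam]) ((len t)%:R `^ p)%:E * mu (W s t) < +oo)%E].
Proof.
have [len [len_word len_le]] := word_length hSL.
have [e einj'] := countable_injP _ cL.
have einj : injective e by move=> x y; apply: einj'; rewrite inE.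
pose hit s t := aG s @^-1` (aL t^-1%g @^-1` Y).
pose W s t := Y `&` hit s t `&` \bigcap_(k in [set k | lex_lt len e k t]) ~` hit s k.
have mY : measurable Y := rc_measurableX H.
have mhit s t : measurable (hit s t).
  by apply: (measurable_actG H); exact: (measurable_actL H).
have mW s t : measurable (W s t).
  apply: measurableI; first exact: measurableI.
  rewrite -[Z in measurable Z]setCK; apply: measurableC; rewrite setC_bigcap.
  rewrite bigcup_mkcond; apply: countable_bigcupT_measurable => // k.
  by case: ifP => // _; rewrite setCK.
exists len, W; split => //.
- by move=> s t x [[_]].
- move=> s x Yx; have Ox := rc_invariantG H s (rc_subX H Yx).
  have [l Yl] := rc_X_ex H Ox.
  have [|t ht mint] := @lex_min _ len e (fun t => hit s t x).
    by exists l^-1%g; rewrite /hit /= invgK.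
  by exists t; split.
move=> s.
have Wuniq t k x : W s t x -> W s k x -> t = k.
  move=> [[_ ht] mt] [[_ hk] mk]; apply: contrapT => tk.
  by have [lt|lt] := lex_lt_total len einj tk; [exact: (mk t)|exact: (mt k)].
(* The cells for a fixed [s] are disjoint, so the sum is the integral of the p-th power of the
   length attached to the cell of x. It remains to bound this length by the orbit distance
   pointwise. *)
apply: le_lt_trans (Lp s).
have -> : (\esum_(t in [set: Lam]) ((len t)%:R `^ p)%:E * mu (W s t) =
    \int[mu]_(x in Y) (\esum_(t in [set: Lam]) ((len t)%:R `^ p * \1_(W s t) x)%:E))%E.
  have mterm t : measurable_fun Y (fun x => ((len t)%:R `^ p * \1_(W s t) x)%:E).
    apply/measurable_EFinP; apply: measurable_funM => //.
  rewrite integral_esum//.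
  apply: eq_esum => t _; under eq_integral do rewrite EFinM.
  rewrite ge0_integralZl//.
  - rewrite integral_indic//; congr (_ * mu _)%E; apply/seteqP; split => [x Wx|x []//].
    by split => //; case: Wx => -[].
  - by apply/measurable_EFinP; exact: measurable_indic.
apply: ge0_le_lower_integral.
- by move=> x [].
- by move=> x; apply: esum_ge0 => t _; rewrite lee_fin mulr_ge0// powR_ge0.
- by move=> x; exact: poweR_ge0.
move=> x Yx.
have [[t Wt]|no] := pselect (exists t, W s t x); last first.
  rewrite esum1 ?poweR_ge0// => t _.
  by rewrite indicE memNset ?mulr0// => Wt; apply: no; exists t.
rewrite (esum_single (i0 := t)); last 2 first.
- by rewrite lee_fin mulr_ge0// powR_ge0.
- by move=> k kt; rewrite indicE memNset ?mulr0// => Wk; apply: kt; exact: Wuniq Wk Wt.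
rewrite indicE mem_set// mulr1 -poweR_EFin.
(* Any word leading from s.x to s*x evaluates to an element of [hit s], and [t] has minimal length
   among those. *)
have le_dist : ((len t)%:R%:E <= orbit_dist R SL aL (Defs.induced aG aL X s x) (aG s x))%E.
  apply: le_ereal_inf_tmp => _ [w [wSL /= E] <-].
  have [y [oy Xy]] : action_orbit aL (aG s x) `&` X !=set0.
    case: Wt => -[_ [ht _]] _; exists (aL t^-1%g (aG s x)).
    by split => //; exists t^-1%g.
  (* The default value of [induced] is not taken here, since [y] shows that the orbit meets [X]. *)
  have [[l _ iE] Xi] : (action_orbit aL (aG s x) `&` X) (Defs.induced aG aL X s x).
    by rewrite /Defs.induced; apply: xgetPex; exists y.
  have hitw : hit s (\prod_(z <- w) z)%g x.
    rewrite /hit /= E (action_inv_l _ _ (rc_actionL H)); split => //.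
    rewrite -iE; apply: (rc_invariantL H); apply: (rc_invariantG H).
    exact: (rc_subX H Yx).
  rewrite lee_fin ler_nat; apply: leq_trans (len_le _ wSL).
  rewrite leqNgt; apply/negP => lt; case: Wt => _ min.
  by apply: (min (\prod_(z <- w) z)%g) => //=; rewrite /lex_lt lt.
have len0 : (0 <= (len t)%:R%:E :> \bar R)%E by rewrite lee_fin.
apply: gt0_ler_poweR => //; rewrite in_itv/= leey andbT//.
exact: le_trans len0 le_dist.
Qed.

End Displacement.

(** * Transferring a function from Lam to Gam *)

Section Transfer.
Variables (R : realType) (p : R) (Gam Lam : groupType).
Variables (SG : set Gam) (SL : set Lam).
Hypothesis hp : 1 <= p.
Hypothesis cG : countable [set: Gam].
Hypothesis cL : countable [set: Lam].
Hypothesis fSG : finite_set SG.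
Hypothesis fSL : finite_set SL.
Variables (d : measure_display) (T : measurableType d).
Variable mu : {measure set T -> \bar R}.
Variables (aG : Gam -> T -> T) (aL : Lam -> T -> T) (D X Om : set T).
Hypothesis H : reduced_coupling mu aG aL D X Om.
Variables (len : Lam -> nat) (W : Gam -> Lam -> set T).
Hypothesis len_word : forall t, exists w : seq Lam,
  [/\ [set` w] `<=` SL, size w = len t & t = (\prod_(s <- w) s)%g].
Hypothesis mW : forall s t, measurable (W s t).
Hypothesis W_hit : forall s t x, W s t x -> X (aL t^-1%g (aG s x)).
Hypothesis W_ex : forall s x, X x -> exists t, W s t x.
Hypothesis W_fin : forall s,
  (\esum_(t in [set: Lam]) ((len t)%:R `^ p)%:E * mu (W s t) < +oo)%E.

Let p_gt0 : 0 < p. Proof. exact: lt_le_trans hp. Qed.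
Let p_ge0 : 0 <= p. Proof. exact: ltW. Qed.
Let p_neq0 : p != 0. Proof. exact: lt0r_neq0. Qed.
Let act_comm := rc_commute H.

(* For y = l^-1 * x with x in X, this is the p-norm of f on the coset of l
   modulo the stabilizer of x; it replaces f l when the action of Lam is not
   free. *)
Definition transfer (f : Lam -> R) (y : T) : R :=
  pnorm p (fun l => f l * \1_X (aL l y)).

Lemma fsupp_cut (f h : Lam -> R) : fsupp f -> fsupp (fun l => f l * h l).
Proof. by apply: fsupp_sub => l; apply: contra => /eqP ->; rewrite mul0r. Qed.

Lemma transfer_powR f y : fsupp f ->
  (((transfer f y) `^ p)%:E =
    \esum_(l in [set: Lam]) (`|f l| `^ p * \1_X (aL l y))%:E)%E.
Proof.
move=> ff; rewrite pnorm_esum//; last exact: fsupp_cut.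
apply: eq_esum => l _; rewrite indicE; case: (_ \in _); first by rewrite !mulr1.
by rewrite !mulr0 normr0 powR0.
Qed.

(** All [l] with l*y in [X] give the same point x, so the [t] of the cell of x serves for all of
    them. The elements bringing s*y into [X] are then the [t^-1 * l], and both transfers are norms
    over the same set of [l], of a shift of [f] and of [f]; the reverse Minkowski inequality
    compares them. *)
Lemma transfer_step f s y : fsupp f -> Om y -> exists t,
  ((`|transfer f (aG s y) - transfer f y| `^ p)%:E <=
    \esum_(l in [set: Lam])
      (`|f (t^-1 * l)%g - f l| `^ p * \1_(W s t) (aL l y))%:E)%E.
Proof.
move=> ff Oy; have [l0 Xl0] := rc_X_ex H Oy.
have [t Wt] := W_ex s Xl0; exists t.
have [_ aLM] := rc_actionL H.
have Xt : X (aL (t^-1 * l0)%g (aG s y)).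
  by rewrite aLM -(act_comm s l0 y); exact: W_hit Wt.
(* Both directions use that a [Lam]-orbit meets [X] in one point; equality of group elements may
   fail because of stabilizers. *)
have sE l : \1_X (aL l (aG s y)) = \1_X (aL (t * l)%g y) :> R.
  rewrite !indicE; congr (_%:R); congr nat_of_bool.
  apply/idP/idP => /set_mem h; apply/mem_set.
  - have E := rc_X_inj H h Xt.
    have E' : aG s (aL (t * l)%g y) = aG s (aL l0 y).
      by rewrite !act_comm aLM E -aLM mulVKg.
    rewrite -(action_inv_l s (aL (t * l)%g y) (rc_actionG H)) E'.
    by rewrite (action_inv_l _ _ (rc_actionG H)).
  - have E := rc_X_inj H h Xl0.
    have -> : aL l (aG s y) = aL t^-1%g (aG s (aL l0 y)).
      by rewrite -E act_comm -aLM mulKg.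
    exact: W_hit Wt.
have -> : transfer f (aG s y) = pnorm p (fun l => f (t^-1 * l)%g * \1_X (aL l y)).
  rewrite -(pnorm_translate _ _ t); congr pnorm; apply/funext => l.
  by rewrite sE mulKg.
have f1 : fsupp (fun l => f (t^-1 * l)%g) by exact: fsupp_translate.
have c1 := fsupp_cut (fun l => \1_X (aL l y)) f1.
have c2 := fsupp_cut (fun l => \1_X (aL l y)) ff.
apply: (@le_trans _ _ ((pnorm p (fun l =>
    f (t^-1 * l)%g * \1_X (aL l y) - f l * \1_X (aL l y))) `^ p)%:E).
  rewrite lee_fin; apply: ge0_ler_powR; rewrite ?nnegrE ?pnorm_ge0//.
  exact: pnorm_dist.
rewrite pnorm_esum//; last exact: fsuppB.
apply: le_esum => l _; rewrite lee_fin -mulrBl !indicE.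
have [/set_mem Xl|] := boolP (aL l y \in X); last first.
  by move=> _; rewrite mulr0 normr0 powR0// mulr_ge0// powR_ge0.
by rewrite mulr1 (rc_X_inj H Xl Xl0) mem_set// mulr1.
Qed.

(** A nonzero transfer at g*z requires some [l] in the support of [f] with l*g*z in [X], hence a
    term 1 in the sum for that [g]. *)
Lemma card_transfer f z K :
  (\esum_(l in [set: Lam]) \esum_(g in [set: Gam])
     (\1_[set l | f l != 0%R] l * \1_X (aL l (aG g z)))%:E <= K%:R%:E :> \bar R)%E ->
  [set g | transfer f (aG g z) != 0] #<= `I_K.
Proof.
rewrite exchange_esum => [|l g]; last by rewrite lee_fin mulr_ge0.
apply: card_le_esum => [g|g /= /eqP gN0].
  by apply: esum_ge0 => l _; rewrite lee_fin mulr_ge0.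
have [l [fl Xl]] : exists l, f l != 0 /\ X (aL l (aG g z)).
  apply: contrapT => no; apply: gN0.
  rewrite /transfer /pnorm fsbig1 ?powR0 ?invr_eq0// => l _.
  have [fl|fl] := eqVneq (f l) 0; first by rewrite fl mul0r normr0 powR0.
  by rewrite indicE memNset ?mulr0 ?normr0 ?powR0// => Xl; apply: no; exists l.
apply: esum_ge; exists [set l]; first by split.
by rewrite fsbig_set1 !indicE !mem_set// mulr1.
Qed.

Lemma mass_le f z M : fsupp f -> fsupp (fun g => transfer f (aG g z)) ->
  (\esum_(l in [set: Lam]) \esum_(g in [set: Gam])
     (`|f l| `^ p * \1_(bounded_part R aG X M) (aL l (aG g z)))%:E <=
   (pnorm p (fun g => transfer f (aG g z)) `^ p)%:E)%E.
Proof.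
move=> ff fphi; rewrite exchange_esum => [|l g]; last first.
  by rewrite lee_fin mulr_ge0// powR_ge0.
rewrite pnorm_esum//; apply: le_esum => g _.
rewrite ger0_norm ?pnorm_ge0// transfer_powR//; apply: le_esum => l _.
rewrite lee_fin ler_wpM2l ?powR_ge0// !indicE ler_nat.
have [/set_mem []|//] := boolP (_ \in bounded_part _ _ _ _) => Xl _.
by rewrite mem_set.
Qed.

(** For fixed [l], the [g] with l*g*z in the bounded part number at most [M]: the actions commute,
    so these points lie in the [Gam]-orbit of l*z, along which the multiplicity is constant. *)
Lemma mass_bounded f z M : fsupp f ->
  (\esum_(l in [set: Lam]) \esum_(g in [set: Gam])
     (`|f l| `^ p * \1_(bounded_part R aG X M) (aL l (aG g z)))%:E <=
   (M%:R * pnorm p f `^ p)%:E)%E.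
Proof.
move=> ff.
have fiber l : (\esum_(g in [set: Gam]) (\1_(bounded_part R aG X M) (aL l (aG g z)))%:E
    <= M%:R%:E :> \bar R)%E.
  have [[g0 [Xg0 /= kM]]|no] :=
      pselect (exists g, bounded_part R aG X M (aL l (aG g z))); last first.
    rewrite esum1// => g _; rewrite indicE memNset// => Bg.
    by apply: no; exists g.
  apply: le_trans kM; rewrite -act_comm (multiplicity_act H).
  apply: le_esum => g _; rewrite lee_fin !indicE ler_nat act_comm.
  have [/set_mem []|//] := boolP (_ \in bounded_part _ _ _ _) => Xl _.
  by rewrite mem_set.
rewrite EFinM (pnorm_esum hp ff) -ge0_esumZl//.
apply: le_esum => l _; under eq_esum do rewrite EFinM.
rewrite ge0_esumZl// ?powR_ge0// muleC; apply: lee_wpmul2r => //.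
Qed.

(** The index is [(s, (t, l))]: the p-th power of the jump of [f] paid when l*y lies in the cell
    [W s t]. The indicator confines [s] to the generators, so that sums may run over the whole index
    type. *)
Definition grad_weight (f : Lam -> R) (j : Gam * (Lam * Lam)) : R :=
  \1_SG j.1 * `|f (j.2.1^-1 * j.2.2)%g - f j.2.2| `^ p.

Lemma grad_weight_ge0 f j : 0 <= grad_weight f j.
Proof. by rewrite mulr_ge0// powR_ge0. Qed.

(** The [t] from [transfer_step] varies with the point; summing over all [t] dominates it without
    selecting one, and gives the form that [transport_sum] integrates. *)
Lemma grad_transfer_le f z : fsupp f -> Om z ->
  fsupp (fun g => transfer f (aG g z)) ->
  ((grad_pnorm p SG (fun g => transfer f (aG g z)) `^ p)%:E <=
   \esum_(j in [set: Gam * (Lam * Lam)]) \esum_(g in [set: Gam])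
     (grad_weight f j * \1_(W j.1 j.2.1) (aL j.2.2 (aG g z)))%:E)%E.
Proof.
move=> ff Oz fphi.
rewrite exchange_esum => [|j g]; last by rewrite lee_fin mulr_ge0// grad_weight_ge0.
rewrite grad_pnorm_esum//; apply: le_esum => g _.
rewrite -(esum_pair (a := fun s q =>
   (grad_weight f (s, q) * \1_(W s q.1) (aL q.2 (aG g z)))%:E)); last first.
  by move=> s q; rewrite lee_fin mulr_ge0// grad_weight_ge0.
rewrite esum_mkcond; apply: le_esum => s _; case: ifPn => sS; last first.
  by apply: esum_ge0 => q _; rewrite lee_fin mulr_ge0// grad_weight_ge0.
have [t] := transfer_step s ff (rc_invariantG H g Oz).
have [_ aGM] := rc_actionG H.
rewrite -aGM => /le_trans; apply.
apply: le_trans (le_esum_inj (e := fun l : Lam => (t, l)) _ _); last 2 first.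
- by move=> l k [].
- by move=> q; rewrite lee_fin mulr_ge0// grad_weight_ge0.
by apply: le_esum => l _; rewrite /grad_weight /= [\1_SG s]indicE sS mul1r.
Qed.

Lemma grad_shift_le f t : fsupp f ->
  (\esum_(l in [set: Lam]) (`|f (t^-1 * l)%g - f l| `^ p)%:E <=
    ((len t)%:R `^ p * grad_pnorm p SL f `^ p)%:E)%E.
Proof.
move=> ff; rewrite -pnorm_esum//; last first.
  by apply: fsuppB => //; exact: fsupp_translate.
rewrite lee_fin -powRM ?grad_pnorm_ge0//.
apply: ge0_ler_powR; rewrite ?nnegrE ?pnorm_ge0 ?mulr_ge0 ?grad_pnorm_ge0//.
have [w [wS sz tE]] := len_word t.
rewrite -(pnorm_translate _ _ t) -sz tE -(pnormN p).
apply: le_trans (pnorm_grad_word hp fSL ff wS).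
by rewrite le_eqVlt; apply/orP; left; apply/eqP; congr pnorm; apply/funext => l;
  rewrite mulKg opprB.
Qed.

(** [K] is the total p-th power displacement cost of the generators in [SG]. For each [t], the sum
    over [l] is a displacement of [f] by [t], controlled by [len t] times the gradient. *)
Lemma cost_le : exists2 K : R, 0 <= K & forall f, fsupp f ->
  (\esum_(j in [set: Gam * (Lam * Lam)]) (grad_weight f j)%:E * mu (W j.1 j.2.1) <=
    (K * grad_pnorm p SL f `^ p)%:E)%E.
Proof.
pose k s := (\esum_(t in [set: Lam]) ((len t)%:R `^ p)%:E * mu (W s t))%E.
have k0 s : (0 <= k s)%E.
  by apply: esum_ge0 => t _; rewrite mule_ge0// lee_fin powR_ge0.
have kfin : (\esum_(s in SG) k s)%E \is a fin_num.
  rewrite ge0_fin_numE ?esum_ge0// esum_fset// fsbig_finite//.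
  by apply: lte_sum_pinfty => s _; exact: W_fin.
exists (fine (\esum_(s in SG) k s)) => [|f ff]; first by rewrite fine_ge0// esum_ge0.
set Q := grad_pnorm p SL f `^ p.
have Q0 : 0 <= Q by exact: powR_ge0.
rewrite EFinM fineK// muleC [in leRHS]esum_mkcond.
rewrite -ge0_esumZl//; last by move=> s; case: ifP.
rewrite -(esum_pair (a := fun s q => ((grad_weight f (s, q))%:E * mu (W s q.1))%E)); last first.
  by move=> s q; rewrite mule_ge0// lee_fin grad_weight_ge0.
apply: le_esum => s _; case: ifPn => sS; last first.
  rewrite mule0 esum1// => q _.
  by rewrite /grad_weight /= [\1_SG s]indicE (negbTE sS) mul0r mul0e.
rewrite -(esum_pair (a := fun t l => ((grad_weight f (s, (t, l)))%:E * mu (W s t))%E)); last first.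
  by move=> t l; rewrite mule_ge0// lee_fin grad_weight_ge0.
rewrite -ge0_esumZl//.
apply: le_esum => t _.
(* [W s t] lies in a preimage of [X] under measure-preserving maps, so its measure is a real scalar
   that can leave the sum. *)
have Wfin : mu (W s t) \is a fin_num.
  rewrite ge0_fin_numE//; apply: le_lt_trans (rc_finite H).
  rewrite -(measure_actL H t^-1%g (rc_measurableX H)).
  have mA := measurable_actL H t^-1%g (rc_measurableX H).
  rewrite -(measure_actG H s mA); apply: le_measure; rewrite ?inE//.
  - exact: (measurable_actG H s mA).
  - by move=> x; exact: W_hit.
rewrite muleA -EFinM [leRHS]muleC mulrC; under eq_esum do rewrite muleC -(fineK Wfin).
rewrite -(fineK Wfin) ge0_esumZl ?fine_ge0//; last first.
  by move=> l; rewrite lee_fin grad_weight_ge0.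
apply: lee_wpmul2l; first by rewrite lee_fin fine_ge0.
apply: le_trans (grad_shift_le t ff).
by apply: le_esum => l _; rewrite /grad_weight /= [\1_SG s]indicE sS mul1r.
Qed.

Lemma esum_supp_le (f : Lam -> R) n : [set l | f l != 0] #<= `I_n ->
  (\esum_(l in [set: Lam]) (\1_[set l | f l != 0%R] l)%:E <= n%:R%:E :> \bar R)%E.
Proof.
move=> fn; have ff : fsupp f by apply/finite_set_leP; exists n.
rewrite (_ : esum _ _ = \esum_(l in [set l | f l != 0%R]) 1%E); last first.
  rewrite [RHS]esum_mkcond; apply: eq_esum => l _; rewrite indicE.
  by case: (_ \in _).
rewrite esum_fset// fsbig_finite//= sumEFin lee_fin.
by rewrite big_const_seq count_predT iter_addr addr0 ler_nat geq_card_fset_set.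
Qed.

(** If the transferred function failed for every z in [D], integrating the failure over [D] would
    give [B <= K]. Keeping [B] free above [K] also serves the case of a vanishing gradient, where
    [B] can be arbitrarily small. *)
Lemma exists_test_function (K : R) (M n : nat) (f : Lam -> R) (B : R) :
  (0 < M)%N -> ((2^-1)%:E * mu X <= mu (bounded_part R aG X M))%E ->
  (\esum_(j in [set: Gam * (Lam * Lam)]) (grad_weight f j)%:E * mu (W j.1 j.2.1) <=
    K%:E)%E ->
  0 <= K -> K < B -> [set l | f l != 0] #<= `I_n -> f <> cst 0 ->
  exists phi : Gam -> R, [/\ [set g | phi g != 0] #<= `I_(4 * M * n)%N &
    fine (mu X) / 4 * pnorm p f `^ p * grad_pnorm p SG phi `^ p <
      B * pnorm p phi `^ p].
Proof.
move=> M0 Mhalf costK K0 KB fn fneq0.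
have ff : fsupp f by apply/finite_set_leP; exists n.
have B0 : 0 < B by exact: le_lt_trans KB.
have [l1 fl1] : exists l, f l != 0.
  apply: contrapT => no; apply: fneq0; apply/funext => l.
  by apply/eqP/negPn/negP => fl; apply: no; exists l.
have n0 : (0 < n)%N.
  rewrite -(@ltr_nat R) -lte_fin; apply: lt_le_trans (esum_supp_le fn).
  apply: (@lt_le_trans _ _ 1%E) => //; apply: esum_ge.
  exists [set l1]; first by split.
  by rewrite fsbig_set1 indicE mem_set.
set P := pnorm p f `^ p; set m := fine (mu X).
have P0 : 0 < P by rewrite powR_gt0//; exact: pnorm_gt0 fl1.
have Xfin : mu X \is a fin_num by rewrite ge0_fin_numE//; exact: rc_finite H.
have muXE : mu X = m%:E by rewrite fineK.
have m0 : 0 < m.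
  rewrite lt0r fine_ge0// andbT; apply/eqP => m0.
  by apply: (rc_nonzero H); rewrite muXE m0.
apply: contrapT => no.
(* [HM] is the mass seen on the bounded part, [N] bounds the support size and [U] bounds the
   gradient of the function transferred at z. *)
pose HM z := (\esum_(l in [set: Lam]) \esum_(g in [set: Gam])
  (`|f l| `^ p * \1_(bounded_part R aG X M) (aL l (aG g z)))%:E)%E.
pose N z := (\esum_(l in [set: Lam]) \esum_(g in [set: Gam])
  (\1_[set l | f l != 0%R] l * \1_X (aL l (aG g z)))%:E : \bar R)%E.
pose U z := (\esum_(j in [set: Gam * (Lam * Lam)]) \esum_(g in [set: Gam])
  (grad_weight f j * \1_(W j.1 j.2.1) (aL j.2.2 (aG g z)))%:E)%E.
have N0 z : (0 <= N z)%E.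
  by apply: esum_ge0 => l _; apply: esum_ge0 => g _; rewrite lee_fin mulr_ge0.
have HM0 z : (0 <= HM z)%E.
  apply: esum_ge0 => l _; apply: esum_ge0 => g _.
  by rewrite lee_fin mulr_ge0// powR_ge0.
have U0 z : (0 <= U z)%E.
  apply: esum_ge0 => l _; apply: esum_ge0 => g _.
  by rewrite lee_fin mulr_ge0// grad_weight_ge0.
have n0R : 0 < n%:R :> R by rewrite ltr0n.
have scale (g h : R) : B * h <= m / 4 * P * g -> 4 * n%:R * B * h <= n%:R * m * P * g.
  move=> le; have n4 : 0 <= 4 * n%:R :> R by rewrite mulr_ge0.
  have := ler_wpM2l n4 le; rewrite mulrA => /le_trans; apply.
  by rewrite le_eqVlt; apply/orP; left; apply/eqP; field.
(* If [N z] is at most 4Mn, the assumed failure yields the [U] term. Otherwise [HM z] is at most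
   [M * P], and 4nB times this equals BP times 4Mn, which the [N] term dominates. *)
have pointwise z : D z ->
    ((4 * n%:R * B)%:E * HM z <= (n%:R * m * P)%:E * U z + (B * P)%:E * N z)%E.
  move=> Dz; have Oz := rc_subD H Dz.
  have [Nle|Ngt] := leP (N z) ((4 * M * n)%N%:R%:E).
    have sup := card_transfer Nle.
    have fphi : fsupp (fun g => transfer f (aG g z)) by apply/finite_set_leP; exists (4 * M * n)%N.
    apply: le_trans (leeDl _ _); last by rewrite mule_ge0// lee_fin mulr_ge0// ltW.
    have := grad_transfer_le ff Oz fphi; rewrite -/(U z) => gU.
    have nmP0 : 0 <= n%:R * m * P by rewrite !mulr_ge0// ltW.
    apply: le_trans (lee_wpmul2l _ gU); last by rewrite lee_fin.
    apply: le_trans (lee_wpmul2l _ (mass_le M ff fphi)) _.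
      by rewrite lee_fin !mulr_ge0// ltW.
    rewrite -!EFinM lee_fin.
    have : ~ (m / 4 * P * grad_pnorm p SG (fun g => transfer f (aG g z)) `^ p <
        B * pnorm p (fun g => transfer f (aG g z)) `^ p).
      by move=> lt; apply: no; eexists; split; [exact: sup|exact: lt].
    by move=> /negP; rewrite -leNgt; exact: scale.
  apply: le_trans (lee_wpmul2l _ (mass_bounded z M ff)) _.
    by rewrite lee_fin !mulr_ge0// ltW.
  apply: le_trans (leeDr _ _); last by rewrite mule_ge0// lee_fin !mulr_ge0// ltW.
  apply: (@le_trans _ _ ((B * P)%:E * (4 * M * n)%N%:R%:E)%E).
    rewrite -!EFinM lee_fin -/P !natrM le_eqVlt; apply/orP; left; apply/eqP; ring.
  by apply: lee_wpmul2l (ltW Ngt); rewrite lee_fin mulr_ge0// ltW.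
have mD := rc_measurableD H.
have mB := measurable_bounded_part cG H M.
have mX := rc_measurableX H.
have cJ : countable [set: Gam * (Lam * Lam)].
  by rewrite -!setXTT; do 2 apply: countableX => //.
have fp0 l : 0 <= `|f l| `^ p by exact: powR_ge0.
have s0 l : 0 <= \1_[set l | f l != 0%R] l :> R by [].
have mHM : measurable_fun D HM.
  exact: (measurable_transport_sum cG H (c := fun l => `|f l| `^ p)
    (fun l => l) (E := fun=> bounded_part R aG X M)).
have mN : measurable_fun D N.
  exact: (measurable_transport_sum cG H (c := \1_[set l | f l != 0%R])
    (fun l => l) (E := fun=> X)).
have gw0 := grad_weight_ge0 f.
have mU : measurable_fun D U.
  exact: (measurable_transport_sum cG H (c := grad_weight f)
    (fun j => j.2.2) (E := fun j => W j.1 j.2.1)).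
have Bfin : mu (bounded_part R aG X M) \is a fin_num.
  rewrite ge0_fin_numE//; apply: le_lt_trans (rc_finite H).
  by apply: le_measure; rewrite ?inE// => x [].
have intHM : (\int[mu]_(z in D) HM z = P%:E * mu (bounded_part R aG X M))%E.
  rewrite (transport_sum cG H (c := fun l => `|f l| `^ p)
    (fun l => l) (E := fun=> bounded_part R aG X M))//.
  under eq_esum do rewrite muleC -(fineK Bfin).
  by rewrite ge0_esumZl ?fine_ge0// -pnorm_esum// fineK// muleC.
have intN : (\int[mu]_(z in D) N z <= n%:R%:E * mu X)%E.
  rewrite (transport_sum cG H (c := \1_[set l | f l != 0%R])
    (fun l => l) (E := fun=> X))//.
  under eq_esum do rewrite muleC muXE.
  rewrite ge0_esumZl ?(ltW m0)// muXE muleC.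
  by apply: lee_wpmul2r; [rewrite lee_fin ltW|exact: esum_supp_le].
have intU : (\int[mu]_(z in D) U z <= K%:E)%E.
  by rewrite (transport_sum cG H (c := grad_weight f)
    (fun j => j.2.2) (E := fun j => W j.1 j.2.1)).
have nmP0 : 0 <= n%:R * m * P by rewrite !mulr_ge0// ltW.
have nB0 : 0 <= 4 * n%:R * B by rewrite !mulr_ge0// ltW.
have BP0 : 0 <= B * P by rewrite mulr_ge0// ltW.
have int_le : ((4 * n%:R * B)%:E * \int[mu]_(z in D) HM z <=
    (n%:R * m * P)%:E * \int[mu]_(z in D) U z + (B * P)%:E * \int[mu]_(z in D) N z)%E.
  rewrite -!ge0_integralZl// -ge0_integralD//.
  - apply: ge0_le_integral => //.
    + by move=> z _; rewrite mule_ge0// lee_fin.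
    + exact: measurable_funeM.
    + exact: (emeasurable_funD (measurable_funeM _ mU) (measurable_funeM _ mN)).
  - by move=> z _; rewrite mule_ge0// lee_fin.
  - exact: measurable_funeM.
  - by move=> z _; rewrite mule_ge0// lee_fin.
  - exact: measurable_funeM.
(* The half of [mu X] kept by the bounded part makes the left side 2nmPB, against nmPK + nmPB on the
   right: this contradicts [K < B]. *)
have : ((4 * n%:R * B)%:E * (P%:E * ((2^-1)%:E * mu X)) <=
    (n%:R * m * P)%:E * K%:E + (B * P)%:E * (n%:R%:E * mu X))%E.
  apply: (@le_trans _ _ ((4 * n%:R * B)%:E * \int[mu]_(z in D) HM z)%E).
    rewrite intHM; apply: lee_wpmul2l; first by rewrite lee_fin.
    by apply: lee_wpmul2l => //; rewrite lee_fin ltW.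
  apply: (le_trans int_le).
  by apply: leeD; apply: lee_wpmul2l => //; rewrite lee_fin.
rewrite muXE -!EFinM -EFinD lee_fin leNgt => /negP; apply.
rewrite (_ : 4 * n%:R * B * (P * (2^-1 * m)) =
  (n%:R * m * P) * B + B * P * (n%:R * m)); last by field.
by rewrite ltrD2r ltr_pM2l// !mulr_gt0.
Qed.

End Transfer.

(** * Comparison of the profiles *)

Section Domination.
Variables (R : realType) (p : R) (Gam Lam : groupType).
Variables (SG : set Gam) (SL : set Lam).
Hypothesis hp : 1 <= p.
Hypothesis hSG : symmetric_generating_set SG.
Hypothesis hSL : symmetric_generating_set SL.

Let p_gt0 : 0 < p. Proof. exact: lt_le_trans hp. Qed.
Let p_neq0 : p != 0. Proof. exact: lt0r_neq0. Qed.

(** Strictness of the inequality excludes [phi = 0]. A zero gradient gives ratio [+oo]; otherwise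
    take p-th roots. *)
Lemma profile_ge (phi : Gam -> R) n (A B : R) : 0 <= A -> 0 < B ->
  [set g | phi g != 0] #<= `I_n ->
  A * grad_pnorm p SG phi `^ p < B * pnorm p phi `^ p ->
  (((A / B) `^ p^-1)%:E <= isoperimetric_profile p SG n)%E.
Proof.
move=> A0 B0 phin lt.
have g0 := grad_pnorm_ge0 p SG phi.
have phi_neq0 : phi <> cst 0.
  move=> E; move: lt; rewrite E /pnorm fsbig1 => [|g _]; last by rewrite normr0 powR0.
  by rewrite [0 `^ p^-1]powR0 ?invr_eq0// powR0// mulr0 ltNge mulr_ge0// powR_ge0.
apply: (@le_trans _ _ (sobolev_ratio p SG phi)); last first.
  by apply: ereal_sup_ubound; exists phi.
rewrite /sobolev_ratio; case: eqVneq => [_|gN0]; first by rewrite leey.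
have gp : 0 < grad_pnorm p SG phi by rewrite lt0r gN0.
rewrite lee_fin -(powRK_inv hp (divr_ge0 (pnorm_ge0 p phi) g0)).
apply: ge0_ler_powR.
- by rewrite invr_ge0 ltW.
- by rewrite nnegrE divr_ge0// ltW.
- by rewrite nnegrE powR_ge0.
rewrite (powR_quotient p (pnorm_ge0 p phi) g0).
have gpp : 0 < grad_pnorm p SG phi `^ p by exact: powR_gt0.
rewrite ler_pdivrMr// mulrAC ler_pdivlMr//.
by rewrite mulrC [leRHS]mulrC ltW// mulrC.
Qed.

Lemma dominates_profile (d : measure_display) (T : measurableType d)
    (mu : {measure set T -> \bar R}) (aG : Gam -> T -> T) (aL : Lam -> T -> T)
    (X : set T) :
  subquotient_coupling mu aG aL X -> Lp_coupling mu aG aL X p SL ->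
  dominates (isoperimetric_profile p SG) (isoperimetric_profile p SL).
Proof.
move=> sqc Lp.
have cG := symgen_countable hSG; have cL := symgen_countable hSL.
have [fSG _ _] := hSG; have [fSL _ _] := hSL.
have [D [Om H]] := reduction cG cL sqc.
have [len [W [len_word mW W_hit W_ex W_fin]]] := displacement_cells hp hSL H Lp.
have [K0 K0_ge0 costK] := cost_le hp cG cL fSG fSL H len_word mW W_hit W_fin.
have [M [M0 Mhalf]] := bounded_part_large cG H.
set m := fine (mu (X `&` Om)).
have m0 : 0 < m.
  have Xfin : mu (X `&` Om) \is a fin_num by rewrite ge0_fin_numE//; exact: rc_finite H.
  rewrite lt0r fine_ge0// andbT; apply/eqP => m0.
  by apply: (rc_nonzero H); rewrite -(fineK Xfin) -/m m0.
(* Comes from the support bound 4Mn; being an integer, it makes the truncation exact. *)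
exists (4 * M)%N%:R; first by rewrite ltr0n muln_gt0.
have K1 : 0 < 4 * (K0 + 1) / m by rewrite divr_gt0// mulr_gt0// ltr_wpDl.
(* [K0 + 1] replaces [K0] to have a strict bound [K0 * Q < B] when [Q] is positive. *)
exists ((4 * (K0 + 1) / m) `^ p^-1); first exact: powR_gt0.
apply: nearW => n; rewrite -natrM natrK.
apply: ge_ereal_sup => _ [f [/= fN0 fn] <-].
have ff : fsupp f by apply/finite_set_leP; exists n.
set P := pnorm p f `^ p; set Q := grad_pnorm p SL f `^ p.
have P0 : 0 < P.
  rewrite powR_gt0// lt0r pnorm_ge0 andbT; apply/eqP => f0; apply: fN0.
  apply/funext => l; apply/eqP/negPn/negP => /(pnorm_gt0 hp ff).
  by rewrite f0 ltxx.
have Q0 : 0 <= Q by exact: powR_ge0.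
have A0 : 0 < m / 4 * P := mulr_gt0 (divr_gt0 m0 (ltr0n R 4)) P0.
have ge B : K0 * Q < B ->
    (((m / 4 * P / B) `^ p^-1)%:E <= isoperimetric_profile p SG (4 * M * n))%E.
  move=> KB; have K0Q : 0 <= K0 * Q by rewrite mulr_ge0.
  have [phi [phin lt]] := exists_test_function hp cG cL fSG H mW W_hit W_ex M0 Mhalf
    (costK f ff) K0Q KB fn fN0.
  exact: (profile_ge (ltW A0) (le_lt_trans K0Q KB) phin lt).
rewrite /sobolev_ratio; case: eqVneq => [g0|gN0].
  (* With [Q = 0] every positive [B] is allowed; the choice below makes the lower bound equal to an
     arbitrary [r]. *)
  have -> : isoperimetric_profile p SG (4 * M * n) = +oo%E.
    apply/eqyP => r r0.
    have rp : 0 < r `^ p by exact: powR_gt0.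
    have := ge (m / 4 * P / r `^ p); rewrite /Q g0 powR0// mulr0 divr_gt0// => /(_ erefl).
    rewrite (_ : m / 4 * P / (m / 4 * P / r `^ p) = r `^ p); last first.
      by rewrite invf_div mulrCA mulfV ?mulr1// (lt0r_neq0 A0).
    by rewrite powRK_inv// ltW.
  by rewrite gt0_muley// lte_fin powR_gt0.
have gp : 0 < grad_pnorm p SL f by rewrite lt0r gN0 grad_pnorm_ge0.
have Qp : 0 < Q by exact: powR_gt0.
have := ge ((K0 + 1) * Q); rewrite ltr_pM2r// ltrDl ltr01 => /(_ erefl) le.
have Kp : (0 <= ((4 * (K0 + 1) / m) `^ p^-1)%:E)%E by rewrite lee_fin powR_ge0.
apply: le_trans (lee_wpmul2l Kp le).
have K01 : K0 + 1 != 0 by rewrite lt0r_neq0// ltr_wpDl.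
have KQ0 : 0 <= m / 4 * P / ((K0 + 1) * Q).
  exact: divr_ge0 (ltW A0) (mulr_ge0 (addr_ge0 K0_ge0 ler01) Q0).
rewrite -EFinM lee_fin -(powRM _ (ltW K1) KQ0).
rewrite (_ : 4 * (K0 + 1) / m * _ = P / Q); last first.
  have cancel (k a b c : R) : k != 0 -> a != 0 -> c != 0 ->
      4 * k / a * (a / 4 * b / (k * c)) = b / c.
    by move=> k0 a0 c0; field; rewrite k0 a0 c0.
  exact: (cancel _ _ _ _ K01 (lt0r_neq0 m0) (lt0r_neq0 Qp)).
have f0 := pnorm_ge0 p f; have g0 := grad_pnorm_ge0 p SL f.
by rewrite /P /Q -(powR_quotient p f0 g0) (powRK_inv hp (divr_ge0 f0 g0)).
Qed.

End Domination.

Theorem theorem4p3 (R : realType) (p : R) (hp : 1 <= p)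
    (Gam Lam : groupType) (SG : set Gam) (SL : set Lam)
    (hSG : symmetric_generating_set SG) (hSL : symmetric_generating_set SL)
    (h : Lp_measure_quotient p Gam SL \/
         exists m : nat, Lp_measure_subquotient_to_one p m Gam SL) :
  dominates (isoperimetric_profile p SG) (isoperimetric_profile p SL).
Proof.
case: h => [|[m]] [d [T [mu [aG [aL [X]]]]]].
- by move=> [qc Lp]; exact: dominates_profile (qc_subquotient qc) Lp.
- by move=> [sqc Lp _]; exact: dominates_profile sqc Lp.
Qed.
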